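(* Suppose that $T$ is a locally finite universal theory in a language $\mathscr L$ with a specified order relation $\le$, and suppose that every finite model of $T$ can be extended to a finite lattice-ordered model of $T$. Suppose that (W) is any one of the properties (A1e)–(C2) listed in the context and $\mathscr L'=\mathscr L\cup\{K\}$, where $K$ is a new operation symbol of corresponding arity. Let $T^{(W)}$, in the language $\mathscr L'$, be the extension of $T$ obtained by adding axioms asserting that $K$ satisfies (W). Then the following hold. (1) If $\varphi$ is a universal sentence in $\mathscr L'$ and $\varphi$ fails in some model of $T^{(W)}$, then $\varphi$ fails in some finite model of $T^{(W)}$. (2) Suppose that $\mathscr L'$ is finite and there is an effectively computable function $h_T$ such that, for every $n\in\mathbb N$, every model of $T$ generated by $n$ elements can be extended to a lattice-ordered model of $T$ of cardinality $\le h_T(n)$. Then the set of all the universal consequences of $T^{(W)}$ is decidable. More generally, items (1)–(2) hold if one adds any number of operations, possibly of distinct arities, possibly satisfying distinct properties chosen from (A1e)–(C2). If $T$ contains the axioms for (and in the language of) lattices, then (W) might be chosen to be (C3), too.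
   Context: A universal theory $T$ is locally finite if every finitely generated model of $T$ is finite. A model of $T$ is lattice-ordered if its order $\le$ is a lattice order. A model ''can be extended'' to another one if it is a substructure of it. A universal sentence is one of the form $\forall\bar x\,\psi$ with $\psi$ quantifier-free. Properties of an operation on an ordered structure. For a unary operation $K$: (A1e) extensive ($x\le Kx$ for all $x$); (A1c) contractive ($Kx\le x$ for all $x$); (A2) idempotent ($KKx=Kx$ for all $x$); (A2e) idempotent and extensive; (A2c) idempotent and contractive; (A3) involutive ($KKx=x$ for all $x$); (B1) isotone ($x\le y$ implies $Kx\le Ky$); (B1e) isotone and extensive; (B1c) isotone and contractive; (B2) isotone and idempotent; (B3) a closure operation (isotone, extensive and idempotent); (B4) an interior operation (isotone, contractive and idempotent); (B5) antitone ($x\le y$ implies $Ky\le Kx$). For an $n$-ary operation $F$ ($n\ge 1$, $i,j\ge 0$, $i+j\le n$): (C1)$_{i,j,n}$ $F$ is isotone on the first $i$ components and antitone on the last $j$ components (each component being varied with the other arguments fixed); (C2)$_{i,j,n,h}$ $F$ satisfies (C1)$_{i,j,n}$ and moreover $x_1\le F\bar x,\dots,x_h\le F\bar x$ for all $\bar x$, where $h\le i$ is fixed; (C3)$_{i,j,n,t}$ (for lattice-ordered structures) $F$ satisfies (C1)$_{i,j,n}$ and moreover $t(x_1,\dots,x_i)\le F\bar x$ for all $\bar x$, where $t$ is a given lattice term. No additivity or multiplicativity is assumed for closure and interior operations.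
   Formalization: Item (2) additionally assumes that it is decidable whether a given finite structure is a model of T; without this (2) fails for some T with a non-recursive set of axioms, and the assumption follows from the conclusion of (2). *)

(* Defs.v *)
From mathcomp Require Import all_boot.
From mathcomp Require Import boolp classical_sets functions cardinality.

Set Implicit Arguments.
Unset Strict Implicit.
Unset Printing Implicit Defensive.

Local Open Scope classical_set_scope.
Local Open Scope card_scope.
Local Open Scope nat_scope.

(* The specified binary relation symbol <= belongs to every language and is
   not listed among the relation symbols [relsym]. *)
Record language := Language {
  funsym : Type; funar : funsym -> nat;
  relsym : Type; relar : relsym -> nat }.
Arguments funar {l} f.
Arguments relar {l} r.

Definition finite_language (L : language) :=
  finite_set [set: funsym L] /\ finite_set [set: relsym L].

Section Syntax.
Variable L : language.

Inductive term :=
| Var of nat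
| App (f : funsym L) of ('I_(funar f) -> term).

(* Quantifier-free formulas.  The other connectives are definable from
   falsity and implication. *)
Inductive qf :=
| Bot
| Imp of qf & qf
| Eq of term & term
| Le of term & term
| Rel (r : relsym L) of ('I_(relar r) -> term).

(* A quantifier-free formula stands for the universal sentence which is its
   universal closure, see [holds]; hence a universal theory is a set of
   quantifier-free formulas. *)
Definition theory := set qf.

Record interp (M : Type) := Interp {
  fint : forall f : funsym L, ('I_(funar f) -> M) -> M;
  rint : forall r : relsym L, ('I_(relar r) -> M) -> Prop;
  leint : M -> M -> Prop }.

Record structure := Structure {
  carrier :> Type;
  str :> interp carrier;
  nonempty : inhabited carrier }.

Section Semantics.
Variables (M : Type) (I : interp M).

Fixpoint eval (v : nat -> M) (t : term) : M :=
  match t with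
  | Var n => v n
  | App f ts => fint I (fun i => eval v (ts i))
  end.

Fixpoint sat (v : nat -> M) (p : qf) : Prop :=
  match p with
  | Bot => False
  | Imp a b => sat v a -> sat v b
  | Eq s t => eval v s = eval v t
  | Le s t => leint I (eval v s) (eval v t)
  | Rel r ts => rint I (fun i => eval v (ts i))
  end.

Definition holds (p : qf) := forall v, sat v p.

Definition models (T : theory) := forall p, T p -> holds p.

Definition generated_by n (x : 'I_n -> M) :=
  forall P : set M, (forall i, P (x i)) ->
    (forall f a, (forall i, P (a i)) -> P (fint I (f := f) a)) ->
  forall y, P y.

Definition is_sup x y z := [/\ leint I x z, leint I y z &
  forall u, leint I x u -> leint I y u -> leint I z u].

Definition is_inf x y z := [/\ leint I z x, leint I z y &
  forall u, leint I u x -> leint I u y -> leint I u z].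

Definition partial_order :=
  [/\ forall x, leint I x x,
      forall x y, leint I x y -> leint I y x -> x = y
    & forall x y z, leint I x y -> leint I y z -> leint I x z].

Definition lattice_ordered := partial_order /\
  forall x y, (exists z, is_sup x y z) /\ (exists z, is_inf x y z).

End Semantics.

Definition finite_structure (M : structure) := finite_set [set: M].

(* M is a substructure of N, up to isomorphism. *)
Definition extends (M N : structure) :=
  exists e : M -> N,
    [/\ injective e,
        forall f a, e (fint M (f := f) a) = fint N (f := f) (e \o a),
        forall r a, rint M (r := r) a <-> rint N (r := r) (e \o a)
      & forall x y, leint M x y <-> leint N (e x) (e y)].

Definition entails (T : theory) (p : qf) :=
  forall M : structure, models M T -> holds M p.

Definition consequences (T : theory) : set qf := [set p | entails T p].

Definition locally_finite (T : theory) :=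
  forall (M : structure) n (x : 'I_n -> M),
    models M T -> generated_by M x -> finite_structure M.

Definition order_axioms : theory :=
  [set Le (Var 0) (Var 0)] `|`
  [set Imp (Le (Var 0) (Var 1)) (Imp (Le (Var 1) (Var 0))
     (Eq (Var 0) (Var 1)))] `|`
  [set Imp (Le (Var 0) (Var 1)) (Imp (Le (Var 1) (Var 2))
     (Le (Var 0) (Var 2)))].

(* Meant for a binary symbol [f]. *)
Definition app2 (f : funsym L) (s t : term) :=
  App (f := f) (fun i => if val i == 0 then s else t).

Definition lattice_axioms (meet join : funsym L) : theory :=
  let x := Var 0 in let y := Var 1 in let z := Var 2 in
  let m := app2 meet in let j := app2 join in
  [set Eq (m x y) (m y x)] `|`
  [set Eq (j x y) (j y x)] `|`
  [set Eq (m x (m y z)) (m (m x y) z)] `|`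
  [set Eq (j x (j y z)) (j (j x y) z)] `|`
  [set Eq (m x (j x y)) x] `|`
  [set Eq (j x (m x y)) x] `|`
  [set Imp (Le x y) (Eq (m x y) x)] `|`
  [set Imp (Eq (m x y) x) (Le x y)].

End Syntax.

Arguments Var {L} n.
Arguments Bot {L}.
Arguments order_axioms : clear implicits.

Inductive lterm (i : nat) :=
| LVar of 'I_i
| LMeet of lterm i & lterm i
| LJoin of lterm i & lterm i.

Fixpoint term_of_lterm (L : language) (meet join : funsym L) i (t : lterm i) :=
  match t with
  | LVar k => Var k
  | LMeet s u =>
      app2 meet (term_of_lterm meet join s) (term_of_lterm meet join u)
  | LJoin s u =>
      app2 join (term_of_lterm meet join s) (term_of_lterm meet join u)
  end.

(* [C3] also records which symbols of L denote the lattice operations. *)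
Inductive property (L : language) :=
| A1e | A1c | A2 | A2e | A2c | A3
| B1 | B1e | B1c | B2 | B3 | B4 | B5
| C1 (i j n : nat)
| C2 (i j n h : nat)
| C3 (meet join : funsym L) (i j n : nat) (t : lterm i).

Definition arity L (W : property L) : nat :=
  match W with
  | C1 _ _ n | C2 _ _ n _ | C3 _ _ _ _ n _ => n
  | _ => 1
  end.

(* [C3] is available only when T contains the axioms for lattices. *)
Definition admissible L (T : theory L) (W : property L) : Prop :=
  match W with
  | C1 i j n => 1 <= n /\ i + j <= n
  | C2 i j n h => [/\ 1 <= n, i + j <= n & h <= i]
  | C3 meet join i j n _ =>
      [/\ 1 <= n, i + j <= n, funar meet = 2, funar join = 2 &
          lattice_axioms meet join `<=` consequences T]
  | _ => True
  end.

Section NewOperation.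
Variables (L : language) (K : funsym L).

Let app1 (t : term L) := App (f := K) (fun _ => t).

Definition ax_extensive : theory L := [set Le (Var 0) (app1 (Var 0))].
Definition ax_contractive : theory L := [set Le (app1 (Var 0)) (Var 0)].
Definition ax_idempotent : theory L :=
  [set Eq (app1 (app1 (Var 0))) (app1 (Var 0))].
Definition ax_involutive : theory L := [set Eq (app1 (app1 (Var 0))) (Var 0)].
Definition ax_isotone : theory L :=
  [set Imp (Le (Var 0) (Var 1)) (Le (app1 (Var 0)) (app1 (Var 1)))].
Definition ax_antitone : theory L :=
  [set Imp (Le (Var 0) (Var 1)) (Le (app1 (Var 1)) (app1 (Var 0)))].

(* The term K(x_0, ..., x_(n-1)), and the same term with x_p replaced by the
   fresh variable x_n, where n is the arity of K. *)
Definition appK : term L := App (f := K) (fun q => Var q).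
Definition appK_at (p : 'I_(funar K)) : term L :=
  App (f := K) (fun q => if q == p then Var (funar K) else Var q).

Definition ax_monotone (i j : nat) : theory L :=
  [set Imp (Le (Var p) (Var (funar K))) (Le appK (appK_at p))
    | p in [set p : 'I_(funar K) | p < i]] `|`
  [set Imp (Le (Var p) (Var (funar K))) (Le (appK_at p) appK)
    | p in [set p : 'I_(funar K) | funar K - j <= p]].

End NewOperation.

(* [K] is the symbol for the new operation, and [s] translates the symbols of
   the old language L into the new language. *)
Definition axioms (L L' : language) (s : funsym L -> funsym L') (K : funsym L')
    (W : property L) : theory L' :=
  match W with
  | A1e => ax_extensive K
  | A1c => ax_contractive K
  | A2 => ax_idempotent K
  | A2e => ax_idempotent K `|` ax_extensive K
  | A2c => ax_idempotent K `|` ax_contractive K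
  | A3 => ax_involutive K
  | B1 => ax_isotone K
  | B1e => ax_isotone K `|` ax_extensive K
  | B1c => ax_isotone K `|` ax_contractive K
  | B2 => ax_isotone K `|` ax_idempotent K
  | B3 => ax_isotone K `|` ax_extensive K `|` ax_idempotent K
  | B4 => ax_isotone K `|` ax_contractive K `|` ax_idempotent K
  | B5 => ax_antitone K
  | C1 i j _ => ax_monotone K i j
  | C2 i j _ h =>
      ax_monotone K i j `|` [set Le (Var p) (appK K) | p in `I_h]
  | C3 meet join i j _ t =>
      ax_monotone K i j `|` [set Le (term_of_lterm (s meet) (s join) t) (appK K)]
  end.

Section Expansion.
Variables (L : language) (I : Type) (W : I -> property L).

Definition expansion : language := {|
  funsym := funsym L + I;
  funar := fun s => match s with inl f => funar f | inr k => arity (W k) end;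
  relsym := relsym L;
  relar := @relar L |}.

Fixpoint lift_term (t : term L) : term expansion :=
  match t with
  | Var n => Var n
  | App f ts => @App expansion (inl f) (fun i => lift_term (ts i))
  end.

Fixpoint lift_qf (p : qf L) : qf expansion :=
  match p with
  | Bot => Bot
  | Imp a b => Imp (lift_qf a) (lift_qf b)
  | Eq s t => Eq (lift_term s) (lift_term t)
  | Le s t => Le (lift_term s) (lift_term t)
  | Rel r ts => @Rel expansion r (fun i => lift_term (ts i))
  end.

Definition expand (T : theory L) : theory expansion :=
  lift_qf @` T `|`
  \bigcup_(k in [set: I]) axioms (L' := expansion) inl (inr k) (W k).

End Expansion.

Arguments expand {L I} W T.

(* Total recursive functions.  Minimization is applied only to functions having
   a zero for every value of the parameters; by Kleene's normal form theorem
   this yields all the total mu-recursive functions. *)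
Inductive recursive : forall n : nat, (n.-tuple nat -> nat) -> Prop :=
| rec_zero n (f : n.-tuple nat -> nat) :
    (forall x, f x = 0) -> recursive f
| rec_succ (f : 1.-tuple nat -> nat) :
    (forall x, f x = (thead x).+1) -> recursive f
| rec_proj n (i : 'I_n) (f : n.-tuple nat -> nat) :
    (forall x, f x = tnth x i) -> recursive f
| rec_comp n m (g : m.-tuple nat -> nat) (f : 'I_m -> n.-tuple nat -> nat)
    (h : n.-tuple nat -> nat) :
    recursive g -> (forall i, recursive (f i)) ->
    (forall x, h x = g [tuple f i x | i < m]) -> recursive h
| rec_prim n (f : n.-tuple nat -> nat) (g : n.+2.-tuple nat -> nat)
    (h : n.+1.-tuple nat -> nat) :
    recursive f -> recursive g ->
    (forall x : n.-tuple nat, h [tuple of 0 :: x] = f x) ->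
    (forall k (x : n.-tuple nat), h [tuple of k.+1 :: x] =
       g [tuple of k :: [tuple of h [tuple of k :: x] :: x]]) ->
    recursive h
| rec_mu n (f : n.+1.-tuple nat -> nat) (h : n.-tuple nat -> nat) :
    recursive f ->
    (forall x : n.-tuple nat, f [tuple of h x :: x] = 0) ->
    (forall (x : n.-tuple nat) k, k < h x -> f [tuple of k :: x] <> 0) ->
    recursive h.

Definition recursive1 (f : nat -> nat) :=
  recursive (fun x : 1.-tuple nat => f (thead x)).

Definition recursive2 (f : nat -> nat -> nat) :=
  recursive (fun x : 2.-tuple nat => f (tnth x ord0) (tnth x ord_max)).

Section Coding.
Variables (L : language) (cf : funsym L -> nat) (cr : relsym L -> nat).

Fixpoint term_code (t : term L) : nat :=
  match t with
  | Var n => CodeSeq.code [:: 0; n]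
  | App f ts =>
      CodeSeq.code [:: 1, cf f & [seq term_code (ts i) | i <- enum 'I_(funar f)]]
  end.

Fixpoint qf_code (p : qf L) : nat :=
  match p with
  | Bot => CodeSeq.code [:: 0]
  | Imp a b => CodeSeq.code [:: 1; qf_code a; qf_code b]
  | Eq s t => CodeSeq.code [:: 2; term_code s; term_code t]
  | Le s t => CodeSeq.code [:: 3; term_code s; term_code t]
  | Rel r ts =>
      CodeSeq.code [:: 4, cr r & [seq term_code (ts i) | i <- enum 'I_(relar r)]]
  end.

Definition decidable_sentences (S : set (qf L)) :=
  exists2 d, recursive1 d & forall p, d (qf_code p) = 1 <-> S p.

(* The atomic facts f(a) = y, r(a) and x <= y which are true in a structure
   with domain {0, ..., m-1}, coded by natural numbers. *)
Inductive fact m (I : interp L 'I_m) : nat -> Prop :=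
| fact_fun f (a : 'I_(funar f) -> 'I_m) :
    fact I (CodeSeq.code
      [:: 0, cf f, nat_of_ord (fint I a)
        & [seq nat_of_ord (a i) | i <- enum 'I_(funar f)]])
| fact_rel r (a : 'I_(relar r) -> 'I_m) : rint I a ->
    fact I (CodeSeq.code
      [:: 1, cr r & [seq nat_of_ord (a i) | i <- enum 'I_(relar r)]])
| fact_le x y : leint I x y ->
    fact I (CodeSeq.code [:: 2; nat_of_ord x; nat_of_ord y]).

(* There is an algorithm which, given a finite structure (with nonempty domain
   {0, ..., m-1}, presented by a list of its atomic facts), decides whether it
   is a model of T. *)
Definition decidable_finite_models (T : theory L) :=
  exists2 d, recursive2 d &
    forall m (I : interp L 'I_m) (s : seq nat), 0 < m ->
      (forall c, c \in s <-> fact I c) ->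
      (d m (CodeSeq.code s) = 1 <-> models I T).

End Coding.

(* Main.v *)
Require Import Defs.
From mathcomp Require Import all_boot.
From mathcomp Require Import boolp classical_sets functions cardinality.
From mathcomp Require Import zify.

(** Let a quantifier-free formula [p] fail in a model [M] of the extended
    theory.  Only the values of the subterms of [p] matter.  They generate a
    finite substructure [A] of the reduct of [M] to the old language, and [A]
    embeds into a finite lattice-ordered model [N] of [T].  It remains to define
    the new operations on [N] so that they have the required properties and
    take the values needed for the evaluation of [p].

    The elements of [A] give a partial isomorphism [Q] between [N] and [M], and
    through it every new operation [K] of [M] becomes a partial operation on
    [N], known where the arguments and the value lie in [A].  It is extended to
    a total operation as follows.  If the property does not involve
    monotonicity, take the identity at all other points ([lift_or_id]).  If it
    does, let [F x] be the join, in the complete lattice [N], of all known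
    values [K b] with [b] below [x]; extensivity, or the requirement that [F]
    dominates a component or a lattice term, is met by adding these bounds to
    the join ([monotone_lift]).  The contractive cases are the extensive ones
    for the opposite order.  This [F] need not be idempotent when [K] is,
    because a join of known values may lie above a known argument that was not
    below [x]; the passage to the least [F]-closed element above [F x] repairs
    this and keeps the known values ([idempotent_hull]).  All this is
    [satisfies_lift].  The new operations do not constrain each other, so all of
    them are added to the same [N], where [p] still fails
    ([refutation_in_extension]).

    For decidability, [p] has at most as many subterms as its code [c], so that
    [p] is a consequence of the extended theory if and only if it holds in all
    the models with domain {0, ..., m-1} for [0 < m <= hT (c + 1)].  A structure
    with this domain is a list of atomic facts, and these lists are among the
    sublists of a list of possible facts that can be computed from [m]; hence a
    bounded search decides the question ([entails_codeP]).  That the search is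
    recursive is shown in a calculus of functions between encoded types: such a
    function is computable when a recursive function does the same on codes.
    Course-of-values recursion ([computable_covrec]) is the main closure
    property; it yields recursion over lists, and over codes of terms and
    formulas. *)

Set Implicit Arguments.
Unset Strict Implicit.
Unset Printing Implicit Defensive.

Local Open Scope classical_set_scope.
Local Open Scope card_scope.
Local Open Scope nat_scope.

(** * Completeness of finite lattices *)

Definition is_order N (le : N -> N -> Prop) :=
  [/\ forall x, le x x,
      forall x y, le x y -> le y x -> x = y
    & forall x y z, le x y -> le y z -> le x z].

Definition opposite N (le : N -> N -> Prop) x y := le y x.

Lemma is_order_opposite N (le : N -> N -> Prop) :
  is_order le -> is_order (opposite le).
Proof.
rewrite /opposite => -[lexx le_anti le_trans]; split=> // [x y lexy leyx|x y z].
  exact: le_anti.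
by move=> /[swap]; apply: le_trans.
Qed.

Definition is_lub N (le : N -> N -> Prop) (S : set N) z :=
  (forall y, S y -> le y z) /\ forall u, (forall y, S y -> le y u) -> le z u.

Definition complete N (le : N -> N -> Prop) := forall S, exists z, is_lub le S z.

Lemma finite_set_enum X (A : set X) : finite_set A ->
  exists n (g : 'I_n -> X), [/\ A #= `I_n, injective g &
    forall y, A y <-> exists i, g i = y].
Proof.
move=> [n An]; have /card_set_bijP[f [f_lt f_inj f_surj]] := An.
have /choice[g gK] (i : 'I_n) : exists y, A y /\ f y = i.
  by have [y Ay <-] := f_surj i (ltn_ord i); exists y.
have Ag i : A (g i) by case: (gK i).
have fg i : f (g i) = i by case: (gK i).
exists n, g; split=> // [i j /(congr1 f)|y]; first by rewrite !fg => /val_inj.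
split=> [Ay|[i <-] //]; exists (Ordinal (f_lt y Ay)).
by apply: f_inj; rewrite ?inE // fg.
Qed.

(** Finite joins are iterated binary joins; [bot] stands in for the join of the
    empty set.  It is arbitrary, because the least element is itself obtained
    from this lemma, applied to the opposite order. *)
Lemma lub_above_bottom N (le : N -> N -> Prop) n (g : 'I_n -> N) bot :
  is_order le -> (forall y, exists i, g i = y) ->
  (forall x y, exists z, is_lub le [set w | w = x \/ w = y] z) ->
  forall S, exists z, is_lub le (bot |` S) z.
Proof.
move=> [lexx _ le_trans] g_surj joins S.
suff [z [ubz leastz]] : exists z,
    is_lub le (bot |` [set y | exists2 i, i \in enum 'I_n & g i = y /\ S y]) z.
  exists z; split=> [y [->|Sy]|u ubu]; first by apply: ubz; left.
    by have [i gi] := g_surj y; apply: ubz; right; exists i; rewrite ?mem_enum.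
  by apply: leastz => y [->|[i _ [_ Sy]]]; apply: ubu; [left | right].
elim: (enum _) => [|i s [z [ubz leastz]]].
  by exists bot; split=> [y [->|[]]|u] //; apply; left.
case: (pselect (S (g i))) => [Si|nSi]; last first.
  exists z; split=> [y [->|[j]]|u ubu].
  - by apply: ubz; left.
  - rewrite inE => /predU1P[->|sj] [gj Sy]; first by rewrite gj in nSi.
    by apply: ubz; right; exists j.
  apply: leastz => y [->|[j sj gj]]; apply: ubu; first by left.
  by right; exists j => //; rewrite inE sj orbT.
have [w [ubw leastw]] := joins z (g i).
have lezw : le z w by apply: ubw; left.
exists w; split=> [y [->|[j]]|u ubu].
- by apply: le_trans lezw; apply: ubz; left.
- rewrite inE => /predU1P[->|sj] [gj Sy].
    by rewrite -gj; apply: ubw; right.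
  by apply: le_trans lezw; apply: ubz; right; exists j.
apply: leastw => y [->|->].
  apply: leastz => y' [->|[j sj gj]]; apply: ubu; first by left.
  by right; exists j => //; rewrite inE sj orbT.
by apply: ubu; right; exists i; rewrite ?mem_head.
Qed.

Lemma finite_lattice_complete L N (I : interp L N) :
  inhabited N -> finite_set [set: N] -> lattice_ordered I ->
  complete (leint I) /\ complete (opposite (leint I)).
Proof.
move=> [x0] /finite_set_enum[n [g [_ _ gP]]] [le_order lattice].
have g_surj y : exists i, g i = y by apply/gP.
have joins x y : exists z, is_lub (leint I) [set w | w = x \/ w = y] z.
  have [[z [xz yz leastz]] _] := lattice x y; exists z; split=> [w [->|->] //|u ubu].
  by apply: leastz; apply: ubu; [left | right].
have meets x y : exists z, is_lub (opposite (leint I)) [set w | w = x \/ w = y] z.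
  have [_ [z [xz yz leastz]]] := lattice x y; exists z; split=> [w [->|->] //|u ubu].
  by apply: leastz; apply: ubu; [left | right].
have ge_order := is_order_opposite le_order.
have [bot [bot_le _]] := lub_above_bottom x0 ge_order g_surj meets setT.
have [top [le_top _]] := lub_above_bottom x0 le_order g_surj joins setT.
split=> S.
  have [z [ubz leastz]] := lub_above_bottom bot le_order g_surj joins S.
  exists z; split=> [y Sy|u ubu]; first by apply: ubz; right.
  by apply: leastz => y [->|/ubu //]; apply: bot_le; right.
have [z [ubz leastz]] := lub_above_bottom top ge_order g_surj meets S.
exists z; split=> [y Sy|u ubu]; first by apply: ubz; right.
by apply: leastz => y [->|/ubu //]; apply: le_top; right.
Qed.

(** The value of [g] at [x] is the least [y] above [f x] with [f y] below [y].
    Since [f] is increasing along its own values, such a [y] is a fixed point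
    of [f] (the argument of Knaster and Tarski), and this makes [g] idempotent.
    Points that [f] maps to its fixed points keep their values. *)
Lemma idempotent_hull N (le : N -> N -> Prop) (f : N -> N) :
  is_order le -> complete (opposite le) ->
  (forall x y, le x y -> le (f x) (f y)) -> (forall x, le (f x) (f (f x))) ->
  exists g, [/\ forall x y, le x y -> le (g x) (g y), forall x, g (g x) = g x,
    forall x, le (f x) (g x) & forall x y, f x = y -> f y = y -> g x = y].
Proof.
move=> [lexx le_anti le_trans] inf f_mono le_ff.
pose S x : set N := [set y | le (f x) y /\ le (f y) y].
have [g gP] := choice (fun x => inf (S x)).
have g_le x y : le (f x) y -> le (f y) y -> le (g x) y.
  by move=> fxy fyy; apply: (gP x).1.
have le_fg x : le (f x) (g x) by apply: (gP x).2 => y [].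
have fg_le x : le (f (g x)) (g x).
  apply: (gP x).2 => y [fxy fyy]; apply: le_trans (fyy); apply: f_mono.
  exact: g_le.
have fg x : f (g x) = g x.
  apply: le_anti => //; apply: g_le; last exact: f_mono.
  by apply: le_trans (le_ff x) _; apply: f_mono.
exists g; split=> // [x y lexy|x|x y fx fy].
- by apply: g_le => //; apply: le_trans (le_fg y); apply: f_mono.
- by apply: le_anti; [apply: g_le | have := le_fg (g x)]; rewrite fg.
apply: le_anti; last by rewrite -fx.
by apply: g_le; rewrite ?fx ?fy.
Qed.

(** * Extension of partially known operations *)

Section PartialIsomorphism.
Variables (N M : Type) (leN : N -> N -> Prop) (leM : M -> M -> Prop).
Variable Q : N -> M -> Prop.

Definition partial_iso := forall b m b' m', Q b m -> Q b' m' ->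
  (leN b b' <-> leM m m').

(** [F] agrees with [K] as far as the partial isomorphism [Q] can tell; the
    arguments of the operations are related by [QX]. *)
Definition lifts XN XM (QX : XN -> XM -> Prop) (K : XM -> M) (F : XN -> N) :=
  forall b m y, QX b m -> Q y (K m) -> F b = y.

Hypotheses (orderN : is_order leN) (orderM : is_order leM) (isoQ : partial_iso).

Lemma partial_iso_inj b b' m : Q b m -> Q b' m -> b = b'.
Proof.
move: orderN orderM => [_ le_anti _] [lexx _ _] Qb Qb'.
by apply: le_anti; [apply/(isoQ Qb Qb') | apply/(isoQ Qb' Qb)].
Qed.

Lemma partial_iso_fun b m m' : Q b m -> Q b m' -> m = m'.
Proof.
move: orderN orderM => [lexx _ _] [_ le_anti _] Qm Qm'.
by apply: le_anti; [apply/(isoQ Qm Qm') | apply/(isoQ Qm' Qm)].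
Qed.

(** The identity is extensive, contractive, idempotent and involutive, so it
    can be used wherever no value of [K] is known. *)
Lemma lift_or_id (K : M -> M) : exists2 F : N -> N, lifts Q K F &
  forall x, (exists m, Q x m /\ Q (F x) (K m)) \/ F x = x.
Proof.
have /choice[F FP] x : exists y, (exists m, Q x m /\ Q y (K m)) \/
    ~ (exists m z, Q x m /\ Q z (K m)) /\ y = x.
  case: (pselect (exists m z, Q x m /\ Q z (K m))) => [[m [z Qxz]]|no].
    by exists z; left; exists m.
  by exists x; right.
exists F => [b m y Qb Qy|x]; last by case: (FP x) => [|[_ ->]]; [left | right].
case: (FP b) => [[m' [Qb' QF]]|[no _]]; last by case: no; exists m, y.
by rewrite -(partial_iso_fun Qb Qb') in QF; apply: partial_iso_inj QF Qy.
Qed.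

(** The lift sends [x] to the join of all values [K b] known for some [b]
    below [x] and of the bounds [gN j x].  [RN] and [RM] compare arguments, so
    that the lemma covers operations which are isotone in some components and
    antitone in others. *)
Lemma monotone_lift XN XM (QX : XN -> XM -> Prop)
    (RN : XN -> XN -> Prop) (RM : XM -> XM -> Prop) (K : XM -> M)
    J (gN : J -> XN -> N) :
  complete leN ->
  (forall x, RN x x) -> (forall x y z, RN x y -> RN y z -> RN x z) ->
  (forall b m b' m', QX b m -> QX b' m' -> RN b b' -> RM m m') ->
  (forall m m', RM m m' -> leM (K m) (K m')) ->
  (forall j x y, RN x y -> leN (gN j x) (gN j y)) ->
  (forall j b m y, QX b m -> Q y (K m) -> leN (gN j b) y) ->
  exists F, [/\ lifts QX K F, forall x y, RN x y -> leN (F x) (F y),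
    forall j x, leN (gN j x) (F x) &
    forall x z, (forall b m y, QX b m -> Q y (K m) -> RN b x -> leN y z) ->
      (forall j, leN (gN j x) z) -> leN (F x) z].
Proof.
move: orderN => [lexx le_anti le_trans] sup Rxx R_trans QR K_mono g_mono g_le.
pose S x : set N := [set y | (exists b m, [/\ QX b m, Q y (K m) & RN b x]) \/
                             exists j, y = gN j x].
have [F FP] := choice (fun x => sup (S x)).
exists F; split=> [b m y Qb Qy|x y Rxy|j x|x z ub_known ub_g].
- apply: le_anti; last by apply: (FP b).1; left; exists b, m.
  apply: (FP b).2 => y' [[b' [m' [Qb' Qy' Rb]]]|[j ->]]; last exact: g_le Qb Qy.
  by apply/(isoQ Qy' Qy); apply: K_mono; apply: QR Rb.
- apply: (FP x).2 => w [[b [m [Qb Qw Rbx]]]|[j ->]].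
    by apply: (FP y).1; left; exists b, m; split=> //; apply: R_trans Rxy.
  by apply: le_trans (g_mono _ _ _ Rxy) _; apply: (FP y).1; right; exists j.
- by apply: (FP x).1; right; exists j.
apply: (FP x).2 => w [[b [m [Qb Qw Rbx]]]|[j ->]] //.
exact: ub_known Qb Qw Rbx.
Qed.

(** The last clause, leastness, is what shows that [F x] is below [F (F x)] when
    [K] is idempotent but not extensive. *)
Lemma isotone_lift (K : M -> M) (ext : bool) :
  complete leN -> (forall m m', leM m m' -> leM (K m) (K m')) ->
  (ext -> forall m, leM m (K m)) ->
  exists F, [/\ lifts Q K F, forall x y, leN x y -> leN (F x) (F y),
    ext -> forall x, leN x (F x) &
    forall x z, (forall b m y, Q b m -> Q y (K m) -> leN b x -> leN y z) ->
      (ext -> leN x z) -> leN (F x) z].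
Proof.
move: (orderN) => [lexx _ le_trans] sup K_mono K_ext.
have [|||F [F_lift F_mono F_ext F_least]] := @monotone_lift N M Q leN leM K
  {_ : unit | ext} (fun _ x => x) sup lexx le_trans _ K_mono.
- by move=> b m b' m' Qb Qb' /(isoQ Qb Qb').
- by [].
- by move=> [_ exT] b m y Qb Qy; apply/(isoQ Qb Qy); apply: K_ext.
exists F; split=> // [exT|x z F_le ext_le].
  exact: F_ext (exist _ tt exT).
by apply: F_least => // -[_ /ext_le].
Qed.

(** Known values of [K] are fixed points of the isotone lift [F], because [K] is
    idempotent; hence [F] satisfies the hypotheses of [idempotent_hull], which
    does not disturb the known values. *)
Lemma isotone_idempotent_lift (K : M -> M) (ext : bool) :
  complete leN -> complete (opposite leN) ->
  (forall m m', leM m m' -> leM (K m) (K m')) -> (forall m, K (K m) = K m) ->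
  (ext -> forall m, leM m (K m)) ->
  exists F, [/\ lifts Q K F, forall x y, leN x y -> leN (F x) (F y),
    forall x, F (F x) = F x & ext -> forall x, leN x (F x)].
Proof.
move: (orderN) => [lexx _ le_trans] sup inf K_mono K_idem K_ext.
have [F [F_lift F_mono F_ext F_least]] := isotone_lift sup K_mono K_ext.
have F_fix b m y : Q b m -> Q y (K m) -> F y = y.
  by move=> Qb Qy; apply: F_lift (Qy) _; rewrite K_idem.
have le_FF x : leN (F x) (F (F x)).
  apply: F_least => [b m y Qb Qy lebx|exT].
    rewrite -(F_fix _ _ _ Qb Qy); apply: (F_mono).
    by rewrite -(F_lift _ _ _ Qb Qy); apply: F_mono.
  exact: le_trans (F_ext exT x) (F_ext exT _).
have [G [G_mono G_idem le_FG G_fix]] := idempotent_hull orderN inf F_mono le_FF.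
exists G; split=> // [b m y Qb Qy|exT x].
  by apply: G_fix; [apply: F_lift Qb Qy | apply: F_fix Qb Qy].
by apply: le_trans (le_FG x); apply: F_ext.
Qed.

End PartialIsomorphism.

(** * Lifting the properties of the new operations *)

Definition update M n (x : 'I_n -> M) (p : 'I_n) (y : M) : 'I_n -> M :=
  fun q => if q == p then y else x q.

Definition mixed_monotone M (le : M -> M -> Prop) n (K : ('I_n -> M) -> M) i j :=
  forall (x : 'I_n -> M) (p : 'I_n) y, le (x p) y ->
    (p < i -> le (K x) (K (update x p y))) /\
    (n - j <= p -> le (K (update x p y)) (K x)).

(** The order on tuples for which a function that is isotone on the first [i]
    and antitone on the last [j] components is isotone: the components in
    between must agree. *)
Definition mixed_le M (le : M -> M -> Prop) n i j (x x' : 'I_n -> M) :=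
  forall p : 'I_n, [/\ p < i -> le (x p) (x' p), n - j <= p -> le (x' p) (x p) &
    i <= p -> p < n - j -> x p = x' p].

Section Semantics.
Variables (L : language) (M : Type) (I : interp L M).
Let le := leint I.

Definition extensive (k : M -> M) := forall x, le x (k x).
Definition contractive (k : M -> M) := forall x, le (k x) x.
Definition fixes_values (k : M -> M) := forall x, k (k x) = k x.
Definition isotone (k : M -> M) := forall x y, le x y -> le (k x) (k y).
Definition antitone (k : M -> M) := forall x y, le x y -> le (k y) (k x).

Definition on_diagonal n (K : ('I_n -> M) -> M) (x : M) := K (fun=> x).

(** The semantic counterpart of [axioms].  The unary properties are about the
    values on constant tuples, whatever the arity is, so that no transport
    along an equation [arity W = 1] occurs. *)
Definition satisfies n (K : ('I_n -> M) -> M) (W : property L) : Prop :=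
  match W with
  | A1e => extensive (on_diagonal K)
  | A1c => contractive (on_diagonal K)
  | A2 => fixes_values (on_diagonal K)
  | A2e => fixes_values (on_diagonal K) /\ extensive (on_diagonal K)
  | A2c => fixes_values (on_diagonal K) /\ contractive (on_diagonal K)
  | A3 => involutive (on_diagonal K)
  | B1 => isotone (on_diagonal K)
  | B1e => isotone (on_diagonal K) /\ extensive (on_diagonal K)
  | B1c => isotone (on_diagonal K) /\ contractive (on_diagonal K)
  | B2 => isotone (on_diagonal K) /\ fixes_values (on_diagonal K)
  | B3 => [/\ isotone (on_diagonal K), extensive (on_diagonal K) &
             fixes_values (on_diagonal K)]
  | B4 => [/\ isotone (on_diagonal K), contractive (on_diagonal K) &
             fixes_values (on_diagonal K)]
  | B5 => antitone (on_diagonal K)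
  | C1 i j _ => mixed_monotone le K i j
  | C2 i j _ h => mixed_monotone le K i j /\
      forall (v : nat -> M) p, p < h -> le (v p) (K v)
  | C3 meet join i j _ t => mixed_monotone le K i j /\
      forall v, le (eval I v (term_of_lterm meet join t)) (K v)
  end.

End Semantics.

(** One component is changed at a time, from left to right. *)
Lemma mixed_le_mono M (le : M -> M -> Prop) n i j (K : ('I_n -> M) -> M) x x' :
  is_order le -> mixed_monotone le K i j -> mixed_le le i j x x' ->
  le (K x) (K x').
Proof.
move=> [lexx _ le_trans] K_mono le_xx'.
pose z k := fun q : 'I_n => if q < k then x' q else x q.
suff le_z k : k <= n -> le (K x) (K (z k)).
  have -> : x' = z n by apply: funext => q; rewrite /z ltn_ord.
  exact: le_z.
elim: k => [_|k IHk ltkn].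
  by have -> : z 0 = x by apply: funext.
apply: le_trans (IHk (ltnW ltkn)) _; pose p := Ordinal ltkn.
have zS : z k.+1 = update (z k) p (x' p).
  apply: funext => q; rewrite /z /update ltnS leq_eqVlt.
  by rewrite -[q == k :> nat]/(q == p); case: eqP => [->|].
have zp : z k p = x p by rewrite /z ltnn.
have [lt_i ge_nj eq_mid] := le_xx' p.
case: (ltnP p i) => [ltpi|leip].
  by rewrite zS; apply: (K_mono _ _ _ _).1 => //; rewrite zp; apply: lt_i.
case: (ltnP p (n - j)) => [ltpn|lenp].
  suff -> : z k.+1 = z k by [].
  by rewrite zS -eq_mid // -zp; apply: funext => q; rewrite /update; case: eqP => [->|].
have -> : z k = update (z k.+1) p (x p).
  by apply: funext => q; rewrite zS /update -zp; case: eqP => [->|].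
by apply: (K_mono _ _ _ _).2 => //; rewrite zS /update eqxx; apply: ge_nj.
Qed.

Lemma mixed_monotone_mixed_le M (le : M -> M -> Prop) n i j (K : ('I_n -> M) -> M) :
  is_order le -> i + j <= n ->
  (forall x x', mixed_le le i j x x' -> le (K x) (K x')) ->
  mixed_monotone le K i j.
Proof.
move=> [lexx _ _] leijn K_mono x p y le_xy.
split=> [ltpi|lenp]; apply: K_mono => q; rewrite /update; case: eqP => [->|_];
  split=> // *; lia.
Qed.

Section LatticeTerms.
Variables (L : language) (M : Type) (I : interp L M) (meet join : funsym L).
Hypothesis latticeI : models I (lattice_axioms meet join).

Let op2 (f : funsym L) x y :=
  fint I (fun i : 'I_(funar f) => if val i == 0 then x else y).

Lemma eval_app2 v f (s t : term L) :
  eval I v (app2 f s t) = op2 f (eval I v s) (eval I v t).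
Proof.
by rewrite /app2 /=; congr (fint I _); apply: funext => i; case: ifP.
Qed.

Let le := leint I.
Let m := op2 meet.
Let j := op2 join.

Lemma lattice_op_laws :
  [/\ commutative m, commutative j, associative m, associative j &
   [/\ forall x y, m x (j x y) = x, forall x y, j x (m x y) = x,
       forall x y, le x y -> m x y = x & forall x y, m x y = x -> le x y]].
Proof.
pose v x y z := nth z [:: x; y] : nat -> M.
have ax x y z p : lattice_axioms meet join p -> sat I (v x y z) p.
  by move=> /latticeI.
have axE x y z s t : lattice_axioms meet join (Eq s t) ->
    eval I (v x y z) s = eval I (v x y z) t by apply: ax.
split; [move=> x y | move=> x y | move=> x y z | move=> x y z |
  split=> [x y|x y|x y|x y]].
- have := axE x y x (app2 meet (Var 0) (Var 1)) (app2 meet (Var 1) (Var 0)).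
  by rewrite !eval_app2; apply; do 7 left.
- have := axE x y x (app2 join (Var 0) (Var 1)) (app2 join (Var 1) (Var 0)).
  by rewrite !eval_app2; apply; do 6 left; right.
- have := axE x y z (app2 meet (Var 0) (app2 meet (Var 1) (Var 2)))
    (app2 meet (app2 meet (Var 0) (Var 1)) (Var 2)).
  by rewrite !eval_app2; apply; do 5 left; right.
- have := axE x y z (app2 join (Var 0) (app2 join (Var 1) (Var 2)))
    (app2 join (app2 join (Var 0) (Var 1)) (Var 2)).
  by rewrite !eval_app2; apply; do 4 left; right.
- have := axE x y x (app2 meet (Var 0) (app2 join (Var 0) (Var 1))) (Var 0).
  by rewrite !eval_app2; apply; do 3 left; right.
- have := axE x y x (app2 join (Var 0) (app2 meet (Var 0) (Var 1))) (Var 0).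
  by rewrite !eval_app2; apply; do 2 left; right.
- have := ax x y x (Imp (Le (Var 0) (Var 1)) (Eq (app2 meet (Var 0) (Var 1)) (Var 0))).
  by rewrite /sat !eval_app2; apply; left; right.
have := ax x y x (Imp (Eq (app2 meet (Var 0) (Var 1)) (Var 0)) (Le (Var 0) (Var 1))).
by rewrite /sat !eval_app2; apply; right.
Qed.

Lemma meet_mono x y x' y' : le x x' -> le y y' -> le (m x y) (m x' y').
Proof.
have [mC _ mA _ [_ _ le_m m_le]] := lattice_op_laws.
move=> /le_m mx /le_m my; apply: m_le.
by rewrite -mA (mC x' y') [m y (m y' x')]mA my (mC y x') mA mx.
Qed.

Lemma join_mono x y x' y' : le x x' -> le y y' -> le (j x y) (j x' y').
Proof.
have [mC jC _ jA [mK jK le_m m_le]] := lattice_op_laws.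
have le_j a b : le a b -> j a b = b by move=> /le_m <-; rewrite mC jC jK.
move=> /le_j jx /le_j jy; apply: m_le.
suff E : j (j x y) (j x' y') = j x' y' by rewrite -{1}E mK.
by rewrite -jA (jC x' y') [j y (j y' x')]jA jy (jC y' x') jA jx.
Qed.

(** This is what allows a lattice term as a lower bound in [monotone_lift]. *)
Lemma lattice_term_mono i (t : lterm i) (v v' : nat -> M) :
  (forall x, le x x) -> (forall k, k < i -> le (v k) (v' k)) ->
  le (eval I v (term_of_lterm meet join t)) (eval I v' (term_of_lterm meet join t)).
Proof.
move=> lexx le_vv'; elim: t => [k|s IHs t IHt|s IHs t IHt]; first exact: le_vv'.
  by rewrite [term_of_lterm _ _ _]/= !eval_app2; apply: meet_mono.
by rewrite [term_of_lterm _ _ _]/= !eval_app2; apply: join_mono.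
Qed.

End LatticeTerms.

Lemma eval_lterm_ext (L : language) M (I : interp L M) meet join i (t : lterm i) v v' :
  (forall k, k < i -> v k = v' k) ->
  eval I v (term_of_lterm meet join t) = eval I v' (term_of_lterm meet join t).
Proof.
move=> vv'; elim: t => [k|s IHs t IHt|s IHs t IHt] /=; first exact: vv'.
  by congr (fint I _); apply: funext => q; case: ifP.
by congr (fint I _); apply: funext => q; case: ifP.
Qed.

Lemma order_of_consequences (L : language) (T : theory L) (M : structure L) :
  order_axioms L `<=` consequences T -> models M T -> is_order (leint M).
Proof.
move=> leT MT; pose v x y z := nth z [:: x; y] : nat -> M.
have ax x y z p : order_axioms L p -> sat M (v x y z) p.
  by move=> /leT /(_ M MT).
split=> [x|x y|x y z].
- by apply: (ax x x x (Le (Var 0) (Var 0))); left; left.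
- apply: (ax x y x (Imp (Le (Var 0) (Var 1)) (Imp (Le (Var 1) (Var 0))
    (Eq (Var 0) (Var 1))))); by left; right.
- apply: (ax x y z (Imp (Le (Var 0) (Var 1)) (Imp (Le (Var 1) (Var 2))
    (Le (Var 0) (Var 2))))); by right.
Qed.

Section SatisfiesLift.
Variables (L : language) (T : theory L) (N M : structure L) (Q : N -> M -> Prop).
Hypotheses (leT : order_axioms L `<=` consequences T).
Hypotheses (NT : models N T) (MT : models M T).
Hypotheses (supN : complete (leint N)) (infN : complete (opposite (leint N))).
Hypotheses (isoQ : partial_iso (leint N) (leint M) Q).
Hypothesis Q_fint : forall f a b,
  (forall i, Q (b i) (a i)) -> Q (fint N (f := f) b) (fint M a).

Let orderN := order_of_consequences leT NT.
Let orderM := order_of_consequences leT MT.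
Let leN := leint N.
Let leM := leint M.

Definition pointwise n (b : 'I_n -> N) (m : 'I_n -> M) := forall q, Q (b q) (m q).

Let isoQop : partial_iso (opposite leN) (opposite leM) Q.
Proof. by move=> b m b' m' Qb Qb'; apply: isoQ. Qed.

Lemma unary_lift (K : ('I_1 -> M) -> M) (F : N -> N) :
  lifts Q Q (on_diagonal K) F ->
  lifts Q (@pointwise 1) K (fun b => F (b ord0)).
Proof.
move=> F_lift b m y Qb Qy; apply: F_lift (Qb _) _.
by rewrite (_ : on_diagonal K _ = K m) //; congr K; apply: funext => q; rewrite ord1.
Qed.

(** Tuples are related componentwise.  Components that must agree cause no
    difficulty, since [Q] is a function in this direction. *)
Lemma mixed_lift n (K : ('I_n -> M) -> M) i j J (gN : J -> ('I_n -> N) -> N) :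
  i + j <= n -> mixed_monotone leM K i j ->
  (forall l x y, mixed_le leN i j x y -> leN (gN l x) (gN l y)) ->
  (forall l b m y, pointwise b m -> Q y (K m) -> leN (gN l b) y) ->
  exists F, [/\ lifts Q (@pointwise n) K F, mixed_monotone leN F i j &
    forall l x, leN (gN l x) (F x)].
Proof.
move=> leijn K_mono g_mono g_le; have [lexx le_anti le_trans] := orderN.
have [||||||F [F_lift F_mono F_ge _]] := monotone_lift orderN isoQ
   (RN := mixed_le leN i j) (RM := mixed_le leM i j) (K := K) (gN := gN)
   (QX := @pointwise n) supN.
- by move=> x p; split=> // *; apply: lexx.
- move=> x y z xy yz p; have [xy1 xy2 xy3] := xy p; have [yz1 yz2 yz3] := yz p.
  split=> [lt|le|ge lt]; [apply: le_trans (xy1 lt) (yz1 lt)|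
    apply: le_trans (yz2 le) (xy2 le)|by rewrite xy3 ?yz3].
- move=> b m b' m' Qb Qb' le_bb' p; have [le1 le2 le3] := le_bb' p.
  split=> [lt|le|ge lt]; [apply/(isoQ (Qb p) (Qb' p)); exact: le1|
    apply/(isoQ (Qb' p) (Qb p)); exact: le2|].
  have := Qb' p; rewrite -le3 //.
  exact: (partial_iso_fun orderN orderM isoQ (Qb p)).
- by move=> m m'; apply: mixed_le_mono.
- exact: g_mono.
- exact: g_le.
exists F; split=> //; exact: mixed_monotone_mixed_le.
Qed.

(** Each property needs only facts about known values, which [Q] transfers from
    [M] to [N], and the completeness of [N]. *)
Lemma satisfies_lift (W : property L) n (K : ('I_n -> M) -> M) :
  n = arity W -> admissible T W -> satisfies M K W ->
  exists2 F, satisfies N F W & lifts Q (@pointwise n) K F.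
Proof.
have [lexx _ le_trans] := orderN.
have op_orderN := is_order_opposite orderN.
have unary (K1 : ('I_1 -> M) -> M) V :
    (exists2 F, satisfies N (fun b : 'I_1 -> N => F (b ord0)) V &
      lifts Q Q (on_diagonal K1) F) ->
    exists2 F, satisfies N F V & lifts Q (@pointwise 1) K1 F.
  by move=> [F FV /unary_lift F_lift]; exists (fun b => F (b ord0)).
have ext_bound (k : M -> M) b m y : extensive M k -> Q b m -> Q y (k m) -> leN b y.
  by move=> k_ext Qb Qy; apply/(isoQ Qb Qy).
have ctr_bound (k : M -> M) b m y : contractive M k -> Q b m -> Q y (k m) -> leN y b.
  by move=> k_ctr Qb Qy; apply/(isoQ Qy Qb).
have fix_again (k : M -> M) (F : N -> N) : fixes_values k -> lifts Q Q k F ->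
    (forall x, (exists m, Q x m /\ Q (F x) (k m)) \/ F x = x) -> fixes_values F.
  move=> k_fix F_lift FP x; case: (FP x) => [[m [Qx QF]]|FxE].
    by apply: F_lift (QF) _; rewrite k_fix.
  by rewrite !FxE.
have id_lift := lift_or_id orderN orderM isoQ.
case: W => [||||||||||||| i j n'|i j n' h|meet join i j n' t] en;
  rewrite /= in en; subst n;
  try (move=> _; set k := on_diagonal K => HK; apply: unary).
- have [F F_lift FP] := id_lift k; exists F => // x; rewrite /on_diagonal.
  case: (FP x) => [[m [Qx QF]]|->//]; exact: ext_bound HK Qx QF.
- have [F F_lift FP] := id_lift k; exists F => // x; rewrite /on_diagonal.
  case: (FP x) => [[m [Qx QF]]|->//]; exact: ctr_bound HK Qx QF.
- have [F F_lift FP] := id_lift k; exists F => //; exact: fix_again HK F_lift FP.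
- have [F F_lift FP] := id_lift k; have [k_fix k_ext] := HK.
  exists F => //; split; first exact: fix_again FP.
  move=> x; rewrite /on_diagonal; case: (FP x) => [[m [Qx QF]]|->//].
  exact: ext_bound k_ext Qx QF.
- have [F F_lift FP] := id_lift k; have [k_fix k_ctr] := HK.
  exists F => //; split; first exact: fix_again FP.
  move=> x; rewrite /on_diagonal; case: (FP x) => [[m [Qx QF]]|->//].
  exact: ctr_bound k_ctr Qx QF.
- have [F F_lift FP] := id_lift k; exists F => // x; rewrite /on_diagonal.
  case: (FP x) => [[m [Qx QF]]|FxE]; last by rewrite !FxE.
  by apply: F_lift (QF) _; rewrite [k _]HK.
- have [F [F_lift F_mono _ _]] := isotone_lift orderN isoQ (ext := false) supN HK
    (fun no => False_ind _ (notF no)).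
  by exists F.
- have [k_mono k_ext] := HK.
  have [F [F_lift F_mono F_ext _]] := isotone_lift orderN isoQ (ext := true) supN
    k_mono (fun=> k_ext).
  by exists F => //; split=> //; apply: F_ext.
- have [k_mono k_ctr] := HK.
  have k_mono' m m' : opposite leM m m' -> opposite leM (k m) (k m') by apply: k_mono.
  have [F [F_lift F_mono F_ext _]] := isotone_lift op_orderN isoQop (ext := true) infN
    k_mono' (fun=> k_ctr).
  by exists F => //; split=> [x y|]; [apply: F_mono | apply: F_ext].
- have [k_mono k_fix] := HK.
  have [F [F_lift F_mono F_fix _]] := isotone_idempotent_lift orderN isoQ
    (ext := false) supN infN k_mono k_fix (fun no => False_ind _ (notF no)).
  by exists F.
- have [k_mono k_ext k_fix] := HK.
  have [F [F_lift F_mono F_fix F_ext]] := isotone_idempotent_lift orderN isoQ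
    (ext := true) supN infN k_mono k_fix (fun=> k_ext).
  by exists F => //; split=> //; apply: F_ext.
- have [k_mono k_ctr k_fix] := HK.
  have k_mono' m m' : opposite leM m m' -> opposite leM (k m) (k m') by apply: k_mono.
  have [F [F_lift F_mono F_fix F_ext]] := isotone_idempotent_lift op_orderN isoQop
    (ext := true) infN supN k_mono' k_fix (fun=> k_ctr).
  by exists F => //; split=> [x y||]; [apply: F_mono | apply: F_ext |].
(* An antitone operation is isotone for the opposite order on its argument. *)
- have [||||||F [F_lift F_mono _ _]] := monotone_lift orderN isoQ (QX := Q)
    (RN := opposite leN) (RM := opposite leM) (K := k) (gN := fun j : False => id) supN.
  + exact: lexx.
  + by move=> x y z xy yz; apply: le_trans yz xy.
  + by move=> b m b' m' Qb Qb'; move/(isoQ Qb' Qb).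
  + by move=> m m'; apply: HK.
  + by [].
  + by [].
  by exists F => // x y; apply: F_mono.
- move=> [n_gt0 leijn] K_mono.
  have [||F [F_lift F_mono _]] := mixed_lift
    (gN := fun l : False => False_rect _ l) leijn K_mono.
  + by [].
  + by [].
  by exists F.
- move=> [n_gt0 leijn lehi] [K_mono K_ge].
  have [||F [F_lift F_mono F_ge]] := mixed_lift
    (gN := fun (l : {p : 'I_n' | p < h}) x => x (sval l)) leijn K_mono.
  + by move=> [p ltph] x y /(_ p)[le_xy _ _]; apply: le_xy; apply: leq_trans lehi.
  + move=> [p ltph] b m y Qb Qy; apply/(isoQ (Qb p) Qy).
    have [n0 def_n] : exists n0, n' = n0.+1 by exists n'.-1; rewrite prednK.
    subst n'; have := K_ge (fun k => m (inord k)) p ltph; rewrite inord_val.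
    by congr (leint M _ (K _)); apply: funext => q; rewrite inord_val.
  exists F => //; split=> // v p ltph.
  have ltpn : p < n' by lia.
  exact: (F_ge (exist _ (Ordinal ltpn) ltph) (fun q => v q)).
move=> [n_gt0 leijn meet2 join2 lattT] [K_mono K_ge].
have [n0 def_n] : exists n0, n' = n0.+1 by exists n'.-1; rewrite prednK.
(* [ext] turns a tuple into a valuation.  Its values at [k > n0] are arbitrary, but
   only variables below [i <= n0.+1] occur in [t]. *)
subst n'; pose ext A (x : 'I_n0.+1 -> A) k := x (inord k).
have extK A (x : 'I_n0.+1 -> A) : (fun q : 'I_n0.+1 => ext A x q) = x.
  by apply: funext => q; rewrite /ext inord_val.
have [||F [F_lift F_mono F_ge]] := mixed_lift
  (gN := fun (_ : unit) x => eval N (ext N x) (term_of_lterm meet join t))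
  leijn K_mono.
- move=> _ x y le_xy; apply: lattice_term_mono => // [p /lattT /(_ N NT) //|k ltki].
  have [le_i _ _] := le_xy (inord k); apply: le_i.
  by rewrite inordK //; lia.
- move=> _ b m y Qb Qy.
  have Qt : Q (eval N (ext N b) (term_of_lterm meet join t))
              (eval M (ext M m) (term_of_lterm meet join t)).
    elim: t {K_ge} => [k|s IHs u IHu|s IHs u IHu] /=; first exact: Qb.
      by apply: Q_fint => q; case: ifP.
    by apply: Q_fint => q; case: ifP.
  by apply/(isoQ Qt Qy); have := K_ge (ext M m); rewrite extK.
exists F => //; split=> // v; have := F_ge tt (fun q => v q).
congr (leint N _ _); apply: eval_lterm_ext => k ltki.
by rewrite /ext inordK //; lia.
Qed.

End SatisfiesLift.

(** * Refutations in finite lattice-ordered models *)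

Section Embedding.
Variables (L : language) (A B : Type) (IA : interp L A) (IB : interp L B).
Variable e : A -> B.
Hypotheses (e_inj : injective e)
  (e_fint : forall f a, e (fint IA (f := f) a) = fint IB (e \o a))
  (e_rint : forall r a, rint IA (r := r) a <-> rint IB (e \o a))
  (e_le : forall x y, leint IA x y <-> leint IB (e x) (e y)).

Lemma eval_embedding v t : e (eval IA v t) = eval IB (e \o v) t.
Proof.
elim: t => [k|f ts IHt] //=; rewrite e_fint; congr (fint IB _).
by apply: funext => i /=; apply: IHt.
Qed.

Lemma sat_embedding v p : sat IA v p <-> sat IB (e \o v) p.
Proof.
elim: p => [|p IHp q IHq|t u|t u|r ts] //=.
- by split=> pq /IHp/pq/IHq.
- by rewrite -!eval_embedding; split=> [->|/e_inj].
- by rewrite -!eval_embedding e_le.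
rewrite e_rint; have -> // : e \o (fun i => eval IA v (ts i)) =
  fun i => eval IB (e \o v) (ts i).
by apply: funext => i /=; apply: eval_embedding.
Qed.

Lemma models_embedding (T : theory L) : models IB T -> models IA T.
Proof. by move=> BT p Tp v; apply/sat_embedding; apply: BT. Qed.

End Embedding.

Section GeneratedSubstructure.
Variables (L : language) (M : Type) (I : interp L M) (n : nat) (x : 'I_n -> M).

(** An intersection of closed sets, in the form in which [generated_by] speaks
    of generation. *)
Definition closure : set M := fun y => forall P : set M, (forall i, P (x i)) ->
  (forall f a, (forall i, P (a i)) -> P (fint I (f := f) a)) -> P y.

Lemma closure_gen i : closure (x i).
Proof. by move=> P Px _; apply: Px. Qed.

Lemma closure_fint f (a : 'I_(funar f) -> M) :
  (forall i, closure (a i)) -> closure (fint I a).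
Proof. by move=> Ca P Px PI; apply: (PI) => i; apply: Ca. Qed.

Definition sub_interp : interp L {y | closure y} := Interp
  (fun f a => exist _ (fint I (fun i => sval (a i)))
    (closure_fint (fun i => svalP (a i))))
  (fun r a => rint I (fun i => sval (a i)))
  (fun y z => leint I (sval y) (sval z)).

Lemma sval_closure_inj : injective (fun y : {y | closure y} => sval y).
Proof.
by move=> [y Cy] [z Cz] /= E; subst z; congr exist; apply: Prop_irrelevance.
Qed.

Lemma models_sub_interp (T : theory L) : models I T -> models sub_interp T.
Proof.
exact: (models_embedding (e := fun y => sval y) sval_closure_inj).
Qed.

Lemma sub_interp_generated :
  generated_by sub_interp (fun i => exist _ (x i) (closure_gen i)).
Proof.
move=> P Px PI y.
have [z [/sval_closure_inj <-]] : exists z : {y | closure y}, sval z = sval y /\ P z.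
  apply: (svalP y (fun u => exists z : {y | closure y}, sval z = u /\ P z)) => [i|f a].
    by exists (exist _ (x i) (closure_gen i)).
  move=> /choice[b bP]; exists (fint sub_interp b); split=> /=.
    by congr (fint I _); apply: funext => i; case: (bP i).
  by apply: PI => i; case: (bP i).
by [].
Qed.

End GeneratedSubstructure.

Section Values.
Variables (L : language) (M : Type) (I : interp L M) (v : nat -> M).

Fixpoint term_values (t : term L) : seq M :=
  eval I v t :: match t with
    | Var _ => [::]
    | App f ts => flatten [seq term_values (ts i) | i <- enum 'I_(funar f)]
    end.

Fixpoint qf_values (p : qf L) : seq M :=
  match p with
  | Bot => [::]
  | Imp p q => qf_values p ++ qf_values q
  | Eq t u | Le t u => term_values t ++ term_values u
  | Rel r ts => flatten [seq term_values (ts i) | i <- enum 'I_(relar r)]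
  end.

Variables (cf : funsym L -> nat) (cr : relsym L -> nat).

(** The code of a list [n :: s] is [2 ^ n * (2 * c + 1)] for the code [c] of [s],
    hence at least [n + c + 1]. *)
Lemma size_sumn_code s : sumn s + size s <= CodeSeq.code s.
Proof.
elim: s => [|a s IHs] //; rewrite [CodeSeq.code _]/(2 ^ a * (CodeSeq.code s).*2.+1) /=.
have : a < 2 ^ a by apply: ltn_expl.
nia.
Qed.

Lemma add_leq_code a b c : b + c <= CodeSeq.code [:: a; b; c].
Proof. by apply: leq_trans (size_sumn_code _); rewrite /=; lia. Qed.

Lemma size_flatten_le n (F : 'I_n -> seq M) (c : 'I_n -> nat) :
  (forall i, size (F i) <= c i) ->
  size (flatten [seq F i | i <- enum 'I_n]) <= sumn [seq c i | i <- enum 'I_n].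
Proof.
move=> Fc; rewrite size_flatten /shape -map_comp.
by elim: (enum _) => //= i s IHs; apply: leq_add.
Qed.

Lemma size_term_values t : size (term_values t) <= term_code cf t.
Proof.
elim: t => [k|f ts IHt].
  by apply: leq_trans (size_sumn_code _); rewrite /= addn2.
set s := [seq term_code cf (ts i) | i <- enum 'I_(funar f)].
apply: (leq_trans _ (size_sumn_code [:: 1, cf f & s])).
apply: (@leq_trans (sumn s).+1); first exact: size_flatten_le IHt.
by rewrite [sumn (_ :: _)]/=; lia.
Qed.

(** The code of a formula bounds the number of its subterms, so that the decision
    procedure obtains a bound on the number of generators for free. *)
Lemma size_qf_values p : size (qf_values p) <= qf_code cf cr p.
Proof.
elim: p => [|p IHp q IHq|t u|t u|r ts] //.
- apply: leq_trans (add_leq_code 1 (qf_code cf cr p) (qf_code cf cr q)).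
  by rewrite size_cat leq_add.
- apply: leq_trans (add_leq_code 2 (term_code cf t) (term_code cf u)).
  by rewrite size_cat leq_add ?size_term_values.
- apply: leq_trans (add_leq_code 3 (term_code cf t) (term_code cf u)).
  by rewrite size_cat leq_add ?size_term_values.
set s := [seq term_code cf (ts i) | i <- enum 'I_(relar r)].
apply: (leq_trans _ (size_sumn_code [:: 4, cr r & s])).
apply: (@leq_trans (sumn s)).
  by apply: size_flatten_le => i; apply: size_term_values.
by rewrite [sumn (_ :: _)]/=; lia.
Qed.

End Values.

Section Expansion.
Variables (L : language) (I : Type) (W : I -> property L).
Local Notation L' := (expansion W).

Definition reduct M (IM : interp L' M) : interp L M := Interp
  (fun f a => fint IM (f := inl f : funsym L') a)
  (fun r a => rint IM (r := r : relsym L') a) (leint IM).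

Definition expand_interp M (IM : interp L M)
    (K : forall k, ('I_(arity (W k)) -> M) -> M) : interp L' M :=
  @Interp L' M
    (fun s => match s return ('I_(@funar L' s) -> M) -> M with
              | inl f => fun a => fint IM (f := f) a
              | inr k => fun a => K k a
              end)
    (fun r a => rint IM (r := r) a) (leint IM).

Lemma reduct_expand M (IM : interp L M) K : reduct (expand_interp IM K) = IM.
Proof. by case: IM. Qed.

Section Reduct.
Variables (M : Type) (IM : interp L' M).

Lemma eval_lift v t : eval IM v (lift_term W t) = eval (reduct IM) v t.
Proof.
elim: t => [k|f ts IHt] //=; congr (fint IM _).
by apply: funext => i; apply: IHt.
Qed.

Lemma sat_lift v p : sat IM v (lift_qf W p) <-> sat (reduct IM) v p.
Proof.
elim: p => [|p IHp q IHq|t u|t u|r ts] //=.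
- by split=> pq /IHp/pq/IHq.
- by rewrite !eval_lift.
- by rewrite !eval_lift.
have -> // : (fun i => eval IM v (lift_term W (ts i))) =
  fun i => eval (reduct IM) v (ts i).
by apply: funext => i; apply: eval_lift.
Qed.

Lemma eval_lterm_reduct meet join i (t : lterm i) v :
  eval IM v (term_of_lterm (inl meet : funsym L') (inl join : funsym L') t) =
  eval (reduct IM) v (term_of_lterm meet join t).
Proof.
elim: t => [k|s IHs u IHu|s IHs u IHu] //=; congr (fint IM _);
  by apply: funext => q; case: ifP.
Qed.

Variable k : I.
Let f : funsym L' := inr k.
Let K := fint IM (f := f).
Let n := arity (W k).

Lemma eval_appK v : eval IM v (appK f) = K (fun q => v q).
Proof. by []. Qed.

Lemma eval_appK_at v (p : 'I_n) :
  eval IM v (appK_at (K := f) p) = K (update (fun q => v q) p (v n)).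
Proof.
by rewrite /=; congr K; apply: funext => q; rewrite /update; case: ifP.
Qed.

Lemma models_ax_monotone i j :
  models IM (ax_monotone f i j) <->
  mixed_monotone (leint IM) K i j.
Proof.
split=> [IMax x p y le_xy|K_mono q [[p /= pP <-]|[p /= pP <-]] v].
- pose v q := if insub q is Some q' then x q' else y.
  have vx (q : 'I_n) : v q = x q by rewrite /v valK.
  have vn : v n = y by rewrite /v insubF // ltnn.
  have xE : (fun q : 'I_n => v q) = x by apply: funext.
  split=> pP.
    have : leint IM (v p) (v n) -> leint IM (eval IM v (appK f))
        (eval IM v (appK_at (K := f) p)).
      exact: (IMax _ (or_introl (ex_intro2 _ _ p pP erefl)) v).
    by rewrite eval_appK eval_appK_at xE vx vn; apply.
  have : leint IM (v p) (v n) -> leint IM (eval IM v (appK_at (K := f) p))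
      (eval IM v (appK f)).
    exact: (IMax _ (or_intror (ex_intro2 _ _ p pP erefl)) v).
  by rewrite eval_appK eval_appK_at xE vx vn; apply.
- move=> le_v.
  rewrite [sat _ _ _]/(leint IM (eval IM v (appK f)) (eval IM v (appK_at (K := f) p))).
  by rewrite eval_appK_at; apply: (K_mono _ _ _ _).1.
move=> le_v.
rewrite [sat _ _ _]/(leint IM (eval IM v (appK_at (K := f) p)) (eval IM v (appK f))).
by rewrite eval_appK_at; apply: (K_mono _ _ _ _).2.
Qed.

Lemma models_setU (T1 T2 : theory L') :
  models IM (T1 `|` T2) <-> models IM T1 /\ models IM T2.
Proof.
split=> [H|[H1 H2] p [/H1|/H2] //].
by split=> p Tp; apply: H; [left | right].
Qed.

Lemma models_set1 (p : qf L') : models IM [set p] <-> holds IM p.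
Proof. by split=> [|Ip _ -> //]; apply. Qed.

Lemma models_extensive :
  models IM (ax_extensive f) <-> extensive (reduct IM) (on_diagonal K).
Proof.
by rewrite models_set1; split=> [H x|H v]; [exact: (H (fun=> x)) | exact: H].
Qed.

Lemma models_contractive :
  models IM (ax_contractive f) <-> contractive (reduct IM) (on_diagonal K).
Proof.
by rewrite models_set1; split=> [H x|H v]; [exact: (H (fun=> x)) | exact: H].
Qed.

Lemma models_idempotent :
  models IM (ax_idempotent f) <-> fixes_values (on_diagonal K).
Proof.
by rewrite models_set1; split=> [H x|H v]; [exact: (H (fun=> x)) | exact: H].
Qed.

Lemma models_involutive : models IM (ax_involutive f) <-> involutive (on_diagonal K).
Proof.
by rewrite models_set1; split=> [H x|H v]; [exact: (H (fun=> x)) | exact: H].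
Qed.

Lemma models_isotone :
  models IM (ax_isotone f) <-> isotone (reduct IM) (on_diagonal K).
Proof.
rewrite models_set1; split=> [H x y|H v]; last exact: H.
exact: (H (fun n => if n is 0 then x else y)).
Qed.

Lemma models_antitone :
  models IM (ax_antitone f) <-> antitone (reduct IM) (on_diagonal K).
Proof.
rewrite models_set1; split=> [H x y|H v]; last exact: H.
exact: (H (fun n => if n is 0 then x else y)).
Qed.

Lemma models_axioms (V : property L) :
  models IM (axioms (L' := L') inl f V) <-> satisfies (reduct IM) K V.
Proof.
case: V => [||||||||||||| i j n'|i j n' h|meet join i j n' t]; last 3 first.
- exact: models_ax_monotone.
- apply: iff_trans (models_setU _ _) _; rewrite models_ax_monotone.
  split=> -[K_mono H]; split=> //.
    by move=> v p ltph; exact: (H _ (ex_intro2 _ _ p ltph erefl) v).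
  by move=> _ [p ltph <-] v; exact: (H v p).
- apply: iff_trans (models_setU _ _) _; rewrite models_ax_monotone models_set1.
  split=> -[K_mono H]; split=> // v.
    by have := H v; rewrite /sat eval_lterm_reduct.
  by rewrite /sat eval_lterm_reduct; apply: H.
all: rewrite /axioms /satisfies ?models_setU ?models_extensive ?models_contractive
  ?models_idempotent ?models_involutive ?models_isotone ?models_antitone //.
- by split=> [[[]]|[]].
- by split=> [[[]]|[]].
Qed.

End Reduct.

Lemma models_expand (T : theory L) M (IM : interp L' M) :
  models IM (expand W T) <-> models (reduct IM) T /\
    forall k, satisfies (reduct IM) (fint IM (f := inr k : funsym L')) (W k).
Proof.
split=> [H|[HT HW] p [[q Tq <-] v|[k _ Wp]]].
- split=> [p Tp v|k]; first by apply/sat_lift; apply: H; left; exists p.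
  by apply/models_axioms => p Wp; apply: H; right; exists k.
- by apply/sat_lift; apply: HT.
by move: p Wp; apply/models_axioms.
Qed.

End Expansion.

Section Refutation.
Variables (L : language) (T : theory L) (I : Type) (W : I -> property L).
Local Notation L' := (expansion W).
Hypothesis leT : order_axioms L `<=` consequences T.
Hypothesis HW : forall k, admissible T (W k).

(** The generators are the values of the subterms of [p]; the list is padded with
    [v 0] up to length [n], which also makes [A] nonempty when [p] contains no
    term. *)
Lemma refutation_in_extension (M : structure L') (v : nat -> M) (p : qf L') n :
  models M (expand W T) -> ~ sat M v p -> size (qf_values M v p) < n ->
  exists (A : structure L) (x : 'I_n -> A),
    [/\ models A T, generated_by A x &
     forall N : structure L, extends A N -> models N T -> finite_structure N ->
       lattice_ordered N ->
       exists IN : interp L' N, models IN (expand W T) /\ ~ holds IN p].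
Proof.
move=> /models_expand[MT MW] not_p ltn.
pose R := reduct M; pose x (i : 'I_n) := nth (v 0) (qf_values M v p) i.
pose A := Structure (sub_interp R x)
  (inhabits (exist _ _ (@closure_gen L M R n x (Ordinal ltn)))).
have AT : models A T by apply: models_sub_interp.
exists A, (fun i => exist _ (x i) (@closure_gen L M R n x i)).
split=> //; first exact: sub_interp_generated.
move=> N [e [e_inj e_fint e_rint e_le]] NT finN lattN.
have [supN infN] := finite_lattice_complete (Defs.nonempty N) finN lattN.
pose RS := Structure R (Defs.nonempty M).
(* [b] and [m] are the two images of the same element of [A]. *)
pose Q (b : N) (m : RS) := exists a : A, e a = b /\ sval a = m.
have isoQ : partial_iso (leint N) (leint RS) Q.
  by move=> _ _ _ _ [a [<- <-]] [b [<- <-]]; rewrite -e_le.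
have orderN := order_of_consequences leT NT.
have orderM : is_order (leint RS) := order_of_consequences leT (M := RS) MT.
have Q_choose k (a : 'I_k -> RS) (b : 'I_k -> N) : (forall i, Q (b i) (a i)) ->
    exists c : 'I_k -> A, b = e \o c /\ a = (fun y : A => sval y) \o c.
  move=> /choice[c cP]; exists c.
  by split; apply: funext => i; case: (cP i) => /=.
have Q_fint f a b : (forall i, Q (b i) (a i)) ->
    Q (fint N (f := f) b) (fint RS (f := f) a).
  by move=> /Q_choose[c [-> ->]]; exists (fint A c).
have Q_rint r a b : (forall i, Q (b i) (a i)) ->
    (rint N (r := r) b <-> rint RS (r := r) a).
  by move=> /Q_choose[c [-> ->]]; rewrite -e_rint.
have lift k := satisfies_lift leT NT (M := RS) MT supN infN isoQ Q_fint
  (erefl (arity (W k))) (HW k) (MW k).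
pose F k := s2val (cid2 (lift k)).
pose IN := expand_interp N F; exists IN; split.
  by apply/models_expand; rewrite reduct_expand; split=> // k;
    exact: (s2valP (cid2 (lift k))).
have F_lift k : lifts Q (pointwise Q (n := arity (W k))) _ (F k) :=
  s2valP' (cid2 (lift k)).
(* Variables whose value is outside [A] do not occur in [p]. *)
have /choice[w wQ] k : exists b, closure R x (v k) -> Q b (v k).
  case: (pselect (closure R x (v k))) => [Ck|nCk]; last first.
    by have [b] := Defs.nonempty N; exists b.
  by exists (e (exist _ _ Ck)); exists (exist _ _ Ck).
have Q_closure y : closure R x y -> exists b, Q b y.
  by move=> Cy; exists (e (exist _ _ Cy)); exists (exist _ _ Cy).
pose inA (s : seq M) := all (fun y => `[< closure R x y >]) s.
have inA_flatten k (s : 'I_k -> seq M) :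
    inA (flatten [seq s i | i <- enum 'I_k]) -> forall i, inA (s i).
  move=> s_in i; move: (mem_enum 'I_k i) s_in; rewrite inE.
  elim: (enum _) => //= j l IHl; rewrite inE /inA all_cat.
  by move=> /predU1P[->|/IHl li] /andP[// _ /li].
have evalQ t : inA (term_values M v t) -> Q (eval IN w t) (eval M v t).
  elim: t => [k|f ts IHt] /= /andP[/asboolP Ct ts_in]; first exact: wQ.
  have {}ts_in := inA_flatten _ _ ts_in.
  have {}IHt i : Q (eval IN w (ts i)) (eval M v (ts i)) by apply: IHt.
  case: f ts ts_in Ct IHt => [f|k] ts ts_in Ct IHt /=; first exact: Q_fint.
  have [b Qb] := Q_closure _ Ct.
  by rewrite (F_lift k _ _ b IHt).
have satQ q : inA (qf_values M v q) -> sat IN w q <-> sat M v q.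
  elim: q => [|q IHq r IHr|t u|t u|r ts] //=.
  - rewrite /inA all_cat => /andP[/IHq qE /IHr rE].
    by split=> qr /qE/qr/rE.
  - rewrite /inA all_cat => /andP[/evalQ Qt /evalQ Qu].
    split=> E; first by apply: (partial_iso_fun orderN orderM isoQ Qt); rewrite E.
    by apply: (partial_iso_inj orderN orderM isoQ Qt); rewrite E.
  - rewrite /inA all_cat => /andP[/evalQ Qt /evalQ Qu].
    exact: isoQ Qt Qu.
  move=> ts_in; have {}ts_in := inA_flatten _ _ ts_in.
  by apply: Q_rint => i; apply: evalQ.
move=> /(_ w) INp; apply: not_p; apply/satQ => //.
apply/(all_nthP (v 0)) => i lti; apply/asboolP.
exact: closure_gen (Ordinal (ltn_trans lti ltn)).
Qed.

End Refutation.

(** * Recursive functions on codes of lists *)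

Definition recursive3 (f : nat -> nat -> nat -> nat) :=
  recursive (fun x : 3.-tuple nat => f (nth 0 x 0) (nth 0 x 1) (nth 0 x 2)).

Lemma recursive_ext n (f g : n.-tuple nat -> nat) :
  f =1 g -> recursive f -> recursive g.
Proof. by move=> /funext->. Qed.

Lemma recursive1E f :
  recursive1 f <-> recursive (fun x : 1.-tuple nat => f (nth 0 x 0)).
Proof.
by split; apply: recursive_ext => x; rewrite /thead (tnth_nth 0).
Qed.

Lemma recursive2E f :
  recursive2 f <-> recursive (fun x : 2.-tuple nat => f (nth 0 x 0) (nth 0 x 1)).
Proof.
by split; apply: recursive_ext => x; rewrite !(tnth_nth 0).
Qed.

Lemma recursive_nth n i : i < n -> recursive (fun x : n.-tuple nat => nth 0 x i).
Proof.
by move=> ltin; apply: (@rec_proj _ (Ordinal ltin)) => x; rewrite (tnth_nth 0).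
Qed.

Lemma recursive_comp1 n g (f : n.-tuple nat -> nat) :
  recursive1 g -> recursive f -> recursive (fun x => g (f x)).
Proof.
move=> Rg Rf; apply: (rec_comp (f := fun=> f) Rg) => // x.
by rewrite /thead tnth_mktuple.
Qed.

Lemma recursive_comp2 n g (f1 f2 : n.-tuple nat -> nat) :
  recursive2 g -> recursive f1 -> recursive f2 ->
  recursive (fun x => g (f1 x) (f2 x)).
Proof.
move=> Rg Rf1 Rf2.
apply: (rec_comp (f := fun i : 'I_2 => if i == ord0 then f1 else f2) Rg).
  by move=> i; case: ifP.
by move=> x; rewrite !tnth_mktuple.
Qed.

Lemma recursive_const n c : recursive (fun _ : n.-tuple nat => c).
Proof.
elim: c => [|c IHc]; first exact: rec_zero.
by apply: (recursive_comp1 _ IHc); apply: rec_succ.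
Qed.

(** The parameter is the second argument, as in the primitive recursion scheme. *)
Lemma recursive2_prim f g h : recursive1 f -> recursive3 g ->
  (forall x, h 0 x = f x) -> (forall k x, h k.+1 x = g k (h k x) x) ->
  recursive2 h.
Proof.
move=> /recursive1E Rf Rg h0 hS; apply/recursive2E; apply: (rec_prim Rf Rg).
  by move=> x /=; rewrite h0.
by move=> k x /=; rewrite hS.
Qed.

Lemma recursive1_swap h (f : nat -> nat) :
  recursive2 h -> (forall k, f k = h k 0) -> recursive1 f.
Proof.
move=> Rh fE; apply: (recursive_ext (f := fun x : 1.-tuple nat => h (thead x) 0)).
  by move=> x; rewrite fE.
by apply: recursive_comp2 => //; [exact: rec_proj | exact: recursive_const].
Qed.

Lemma recursive1_id : recursive1 id.
Proof. exact: rec_proj. Qed.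

Lemma recursive1_const c : recursive1 (fun=> c).
Proof. exact: recursive_const. Qed.

Lemma recursive1_succ : recursive1 succn.
Proof. exact: rec_succ. Qed.

Ltac rec_nth := first [exact: recursive_const | exact: recursive_nth].

Lemma recursive2_add : recursive2 addn.
Proof.
apply: (recursive2_prim (f := id) (g := fun _ r _ => r.+1)) => //.
  exact: recursive1_id.
by apply: recursive_comp1; [exact: recursive1_succ | rec_nth].
Qed.

Lemma recursive1_pred : recursive1 predn.
Proof.
apply: (recursive1_swap (h := fun k _ => k.-1)) => //.
apply: (recursive2_prim (f := fun=> 0) (g := fun k _ _ => k)) => //.
  exact: recursive1_const.
rec_nth.
Qed.

(** The arguments are exchanged because recursion is on the first one. *)
Lemma recursive2_subr : recursive2 (fun k x => x - k).
Proof.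
apply: (recursive2_prim (f := id) (g := fun _ r _ => r.-1)) => //.
- exact: recursive1_id.
- by apply: recursive_comp1; [exact: recursive1_pred | rec_nth].
- by move=> x; rewrite subn0.
- by move=> k x; rewrite subnS.
Qed.

Lemma recursive2_sub : recursive2 subn.
Proof.
apply: (recursive_comp2 recursive2_subr); exact: rec_proj.
Qed.

Lemma recursive2_mul : recursive2 muln.
Proof.
apply: (recursive2_prim (f := fun=> 0) (g := fun _ r x => x + r)) => //.
  exact: recursive1_const.
by apply: (recursive_comp2 recursive2_add); rec_nth.
Qed.

Lemma recursive1_exp2 : recursive1 (expn 2).
Proof.
apply: (recursive1_swap (h := fun k _ => 2 ^ k)) => //.
apply: (recursive2_prim (f := fun=> 1) (g := fun _ r _ => 2 * r)) => //.
- exact: recursive1_const.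
- by apply: (recursive_comp2 recursive2_mul); rec_nth.
- by move=> k _; rewrite expnS.
Qed.

Lemma recursive1_half : recursive1 half.
Proof.
apply: (recursive1_swap (h := fun k _ => k./2)) => //.
apply: (recursive2_prim (f := fun=> 0) (g := fun k r _ => k - r)) => //.
- exact: recursive1_const.
- by apply: (recursive_comp2 recursive2_sub); rec_nth.
- by move=> k _ /=; lia.
Qed.

Lemma recursive1_odd : recursive1 odd.
Proof.
apply: (recursive1_swap (h := fun k _ => odd k)) => //.
apply: (recursive2_prim (f := fun=> 0) (g := fun _ r _ => 1 - r)) => //.
- exact: recursive1_const.
- by apply: (recursive_comp2 recursive2_sub); rec_nth.
- by move=> k _ /=; case: (odd k).
Qed.

Lemma recursive2_iter f : recursive1 f -> recursive2 (fun k => iter k f).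
Proof.
move=> Rf.
apply: (recursive2_prim (f := id) (g := fun _ r _ => f r)) => //.
  exact: recursive1_id.
by apply: (recursive_comp1 Rf); rec_nth.
Qed.

(** [consn], [headn] and [tailn] are the list operations on codes.  They also
    serve as a pairing function with its projections. *)
Definition consn a b := 2 ^ a * b.*2.+1.
Definition headn c := head 0 (CodeSeq.decode c).
Definition tailn c := CodeSeq.code (behead (CodeSeq.decode c)).

Lemma headn_cons a b : headn (consn a b) = a.
Proof.
by rewrite /headn -[b]CodeSeq.decodeK -[consn _ _]/(CodeSeq.code (a :: _))
  CodeSeq.codeK.
Qed.

Lemma tailn_cons a b : tailn (consn a b) = b.
Proof.
by rewrite /tailn -{1}[b]CodeSeq.decodeK -[consn _ _]/(CodeSeq.code (a :: _))
  CodeSeq.codeK /= CodeSeq.decodeK.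
Qed.

Lemma consn_split c : 0 < c -> c = consn (headn c) (tailn c).
Proof.
move=> c_gt0; rewrite -[LHS]CodeSeq.decodeK /headn /tailn.
by case E: (CodeSeq.decode c) => [|a s] //; rewrite -[c]CodeSeq.decodeK E in c_gt0.
Qed.

Lemma iter_half_consn k d b : iter k half (consn (k + d) b) = consn d b.
Proof.
elim: k d => //= k IHk d; rewrite addSnnS IHk /consn expnS -mulnA mul2n.
by rewrite doubleK.
Qed.

Lemma recursive2_cons : recursive2 consn.
Proof.
apply: (recursive_comp2 recursive2_mul).
  by apply: (recursive_comp1 recursive1_exp2); apply: rec_proj.
apply: (recursive_comp1 recursive1_succ).
apply: (recursive_ext (f := fun x : 2.-tuple nat => 2 * tnth x ord_max)).
  by move=> x; rewrite mul2n.
by apply: (recursive_comp2 recursive2_mul); [exact: recursive_const | exact: rec_proj].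
Qed.

(** The head is the number of times that the code can be halved before it
    becomes odd, which unbounded search finds. *)
Lemma recursive1_head : recursive1 headn.
Proof.
pose f k c := (1 - odd (iter k half c)) * c.
apply: (rec_mu (f := fun x : 2.-tuple nat => f (nth 0 x 0) (nth 0 x 1))).
- apply: (recursive_comp2 recursive2_mul); last by rec_nth.
  apply: (recursive_comp2 recursive2_sub); first by rec_nth.
  apply: (recursive_comp1 recursive1_odd).
  by apply: (recursive_comp2 (recursive2_iter recursive1_half)); rec_nth.
- move=> x; case/tupleP: x => c s; rewrite theadE /= /f.
  case: (posnP c) => [->|/consn_split E]; first by rewrite muln0.
  rewrite {2}E -[X in consn X]addn0 iter_half_consn /consn expn0 mul1n oddS odd_double.
  by rewrite subnn.
move=> x k; case/tupleP: x => c s; rewrite theadE /= /f => ltk.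
have c_gt0 : 0 < c by case: c ltk => [|//]; rewrite /headn.
rewrite {1}(consn_split c_gt0) -(subnKC ltk) addSnnS iter_half_consn.
by rewrite /consn expnS -mulnA mul2n odd_double subn0 mul1n; lia.
Qed.

Lemma recursive1_tail : recursive1 tailn.
Proof.
apply: (recursive_ext
  (f := fun x : 1.-tuple nat => half (iter (headn (thead x)) half (thead x)))).
  move=> x; case: (posnP (thead x)) => [->//|/consn_split E].
  rewrite {2}E -[X in consn X]addn0 iter_half_consn /consn expn0 mul1n.
  rewrite -[_.+1]/(true + _).
  by rewrite half_bit_double.
apply: (recursive_comp1 recursive1_half).
apply: (recursive_comp2 (recursive2_iter recursive1_half)); last exact: rec_proj.
by apply: (recursive_comp1 recursive1_head); apply: rec_proj.
Qed.

(** * Computable functions between encoded types *)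

Arguments CodeSeq.code : simpl never.

Class encodable (A : Type) := encode : A -> nat.

#[local] Instance encodable_nat : encodable nat := id.
#[local] Instance encodable_bool : encodable bool := nat_of_bool.
#[local] Instance encodable_prod A B (eA : encodable A) (eB : encodable B) :
  encodable (A * B) := fun p => consn (encode p.1) (encode p.2).
#[local] Instance encodable_seq A (eA : encodable A) : encodable (seq A) :=
  fun s => CodeSeq.code (map encode s).

(** Only the encoding is required of an encodable type: the realizer is
    constrained on codes of elements, and decoding is never needed. *)
Definition computable A B (eA : encodable A) (eB : encodable B) (f : A -> B) :=
  exists2 g, recursive1 g & forall a, g (encode a) = encode (f a).
Arguments computable {A B eA eB} f.

Lemma encode_seq_nat (s : seq nat) : encode s = CodeSeq.code s.
Proof. by rewrite /encode /encodable_seq map_id. Qed.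

Lemma encode_cons A (eA : encodable A) (a : A) s :
  encode (a :: s) = consn (encode a) (encode s).
Proof. by []. Qed.

Section Computable.
Context (E A B C : Type) {eE : encodable E} {eA : encodable A}
  {eB : encodable B} {eC : encodable C}.

Lemma computable_ext (f g : E -> A) : f =1 g -> computable f -> computable g.
Proof. by move=> /funext->. Qed.

Lemma computable_id : computable (fun e : E => e).
Proof. by exists id => //; apply: recursive1_id. Qed.

Lemma computable_const (a : A) : computable (fun _ : E => a).
Proof. by exists (fun=> encode a) => //; apply: recursive1_const. Qed.

Lemma computable_comp (g : A -> B) (f : E -> A) :
  computable g -> computable f -> computable (fun e => g (f e)).
Proof.
move=> [g' Rg gE] [f' Rf fE]; exists (fun x => g' (f' x)).
  by apply: (recursive_comp1 Rg); exact: Rf.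
by move=> e; rewrite fE gE.
Qed.

Lemma computable_rec1 (g : nat -> nat) (f : E -> nat) :
  recursive1 g -> computable f -> computable (fun e => g (f e)).
Proof.
move=> Rg [f' Rf fE]; exists (fun x => g (f' x)).
  by apply: (recursive_comp1 Rg); exact: Rf.
by move=> e; rewrite fE.
Qed.

Lemma computable_rec2 (g : nat -> nat -> nat) (f1 f2 : E -> nat) :
  recursive2 g -> computable f1 -> computable f2 ->
  computable (fun e => g (f1 e) (f2 e)).
Proof.
move=> Rg [f1' Rf1 f1E] [f2' Rf2 f2E]; exists (fun x => g (f1' x) (f2' x)).
  by apply: (recursive_comp2 Rg); [exact: Rf1 | exact: Rf2].
by move=> e; rewrite f1E f2E.
Qed.

Lemma computable_pair (f : E -> A) (g : E -> B) :
  computable f -> computable g -> computable (fun e => (f e, g e)).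
Proof.
move=> [f' Rf fE] [g' Rg gE]; exists (fun x => consn (f' x) (g' x)).
  by apply: (recursive_comp2 recursive2_cons); [exact: Rf | exact: Rg].
by move=> e; rewrite fE gE.
Qed.

Lemma computable_fst (f : E -> A * B) :
  computable f -> computable (fun e => (f e).1).
Proof.
move=> [f' Rf fE]; exists (fun x => headn (f' x)).
  by apply: (recursive_comp1 recursive1_head); exact: Rf.
by move=> e; rewrite fE headn_cons.
Qed.

Lemma computable_snd (f : E -> A * B) :
  computable f -> computable (fun e => (f e).2).
Proof.
move=> [f' Rf fE]; exists (fun x => tailn (f' x)).
  by apply: (recursive_comp1 recursive1_tail); exact: Rf.
by move=> e; rewrite fE tailn_cons.
Qed.

(** Primitive recursion, with the environment [e] as parameter. *)
Lemma computable_iteri (G : E -> nat -> A -> A) (z : E -> A) (k : E -> nat) :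
  computable (fun q : E * nat * A => G q.1.1 q.1.2 q.2) ->
  computable z -> computable k ->
  computable (fun e => iteri (k e) (G e) (z e)).
Proof.
move=> [g Rg gE] [z' Rz zE] [k' Rk kE].
pose h k x := iteri k (fun i r => g (consn (consn x i) r)) (z' x).
have Rh : recursive2 h.
  apply: (recursive2_prim (f := z')
    (g := fun i r x => g (consn (consn x i) r))) => //.
  apply: (recursive_comp1 Rg).
  apply: (recursive_comp2 recursive2_cons); last by rec_nth.
  by apply: (recursive_comp2 recursive2_cons); rec_nth.
exists (fun x => h (k' x) x).
  by apply: (recursive_comp2 Rh); [exact: Rk | exact: recursive1_id].
move=> e; rewrite kE /h -[encode (k e)]/(k e).
elim: (k e) => [|i IHi] /=; first exact: zE.
by rewrite IHi -(gE (e, i, _)).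
Qed.

Lemma computable_bool (b : E -> bool) :
  computable (fun e => nat_of_bool (b e)) -> computable b.
Proof. by []. Qed.

Lemma computable_nat_of_bool (b : E -> bool) :
  computable b -> computable (fun e => nat_of_bool (b e)).
Proof. by []. Qed.

Lemma computable_cons (a : E -> A) (s : E -> seq A) :
  computable a -> computable s -> computable (fun e => a e :: s e).
Proof.
move=> [a' Ra aE] [s' Rs sE]; exists (fun x => consn (a' x) (s' x)).
  by apply: (recursive_comp2 recursive2_cons); [exact: Ra | exact: Rs].
by move=> e; rewrite aE sE.
Qed.

Lemma computable_behead (s : E -> seq A) :
  computable s -> computable (fun e => behead (s e)).
Proof.
move=> [s' Rs sE]; exists (fun x => tailn (s' x)).
  by apply: (recursive_comp1 recursive1_tail); exact: Rs.
move=> e; rewrite sE; case: (s e) => [|a t] //.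
by rewrite encode_cons tailn_cons.
Qed.

Lemma computable_head (s : E -> seq nat) :
  computable s -> computable (fun e => head 0 (s e)).
Proof.
move=> [s' Rs sE]; exists (fun x => headn (s' x)).
  by apply: (recursive_comp1 recursive1_head); exact: Rs.
move=> e; rewrite sE; case: (s e) => [|a t] //.
by rewrite encode_cons headn_cons.
Qed.

Lemma computable_code (s : E -> seq nat) :
  computable s -> computable (fun e => CodeSeq.code (s e)).
Proof. by move=> [s' Rs sE]; exists s' => // e; rewrite sE encode_seq_nat. Qed.

Lemma computable_decode (c : E -> nat) :
  computable c -> computable (fun e => CodeSeq.decode (c e)).
Proof.
by move=> [c' Rc cE]; exists c' => // e; rewrite cE encode_seq_nat CodeSeq.decodeK.
Qed.

End Computable.

Section ComputableIf.
Context (E A : Type) {eE : encodable E} {eA : encodable A}.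

Lemma computable_if (b : E -> bool) (x y : E -> A) :
  computable b -> computable x -> computable y ->
  computable (fun e => if b e then x e else y e).
Proof.
move=> [b' Rb bE] Cx Cy.
apply: (computable_ext (f := fun e => iteri (b e) (fun _ _ => x e) (y e))).
  by move=> e; case: (b e).
apply: (computable_iteri (G := fun e _ _ => x e)) => //; last by exists b'.
apply: (computable_comp (g := x) (f := fun q : E * nat * A => q.1.1)) => //.
by do 2! apply: computable_fst; apply: computable_id.
Qed.

End ComputableIf.

Section ComputableNat.
Context (E : Type) {eE : encodable E}.
Implicit Types (m n : E -> nat) (b c : E -> bool).

Lemma computable_succ n : computable n -> computable (fun e => (n e).+1).
Proof. exact: computable_rec1 recursive1_succ. Qed.

Lemma computable_sub m n :
  computable m -> computable n -> computable (fun e => m e - n e).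
Proof. exact: computable_rec2 recursive2_sub. Qed.

Lemma computable_eqn m n :
  computable m -> computable n -> computable (fun e => m e == n e).
Proof.
move=> Cm Cn; apply: computable_bool.
apply: (computable_ext (f := fun e => 1 - ((m e - n e) + (n e - m e)))).
  by move=> e; case: eqP; lia.
apply: computable_sub; first exact: computable_const.
by apply: (computable_rec2 recursive2_add); apply: computable_sub.
Qed.

Lemma computable_neg b : computable b -> computable (fun e => ~~ b e).
Proof. by move=> Cb; apply: (computable_if Cb); apply: computable_const. Qed.

Lemma computable_and b c :
  computable b -> computable c -> computable (fun e => b e && c e).
Proof. by move=> Cb Cc; apply: (computable_if Cb Cc); apply: computable_const. Qed.

Lemma computable_or b c :
  computable b -> computable c -> computable (fun e => b e || c e).
Proof.
by move=> Cb Cc; apply: (computable_if Cb _ Cc); apply: computable_const.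
Qed.

Lemma computable_imp b c :
  computable b -> computable c -> computable (fun e => b e ==> c e).
Proof. by move=> Cb Cc; apply: (computable_if Cb Cc); apply: computable_const. Qed.

Lemma computable_nth (s : E -> seq nat) n :
  computable s -> computable n -> computable (fun e => nth 0 (s e) (n e)).
Proof.
move=> Cs Cn.
apply: (computable_ext (f := fun e => head 0 (iteri (n e) (fun=> behead) (s e)))).
  move=> e; elim: (n e) (s e) => [|k IHk] t; first by rewrite nth0.
  rewrite -nth_behead -IHk /=; congr head.
  by elim: k {IHk} => //= k ->.
apply: computable_head; apply: (computable_iteri (G := fun=> fun=> behead)) => //.
by apply: computable_behead; apply: computable_snd; apply: computable_id.
Qed.

End ComputableNat.

Section CourseOfValues.
Variables (E : Type) (G : E -> nat -> seq nat -> nat).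

(** The list of the values at [n-1], ..., [0], in this order; hence the
    value at [j] is found at position [n - j.+1], see [nth_history]. *)
Definition history e n := iteri n (fun i H => G e i H :: H) [::].

Definition covrec e n := G e n (history e n).

Lemma nth_history e n j :
  j < n -> nth 0 (history e n) (n - j.+1) = covrec e j.
Proof.
elim: n => // n IHn; rewrite ltnS leq_eqVlt => /predU1P[->|ltjn].
  by rewrite subnn.
by rewrite -IHn // subSn.
Qed.

Lemma computable_covrec (eE : encodable E) E' (eE' : encodable E')
    (e : E' -> E) (n : E' -> nat) :
  computable (fun q : E * nat * seq nat => G q.1.1 q.1.2 q.2) ->
  computable e -> computable n -> computable (fun x => covrec (e x) (n x)).
Proof.
move=> CG Ce Cn.
apply: (computable_comp (g := fun q : E * nat * seq nat => G q.1.1 q.1.2 q.2)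
  (f := fun x => (e x, n x, history (e x) (n x)))) => //.
apply: computable_pair; first exact: computable_pair.
apply: (computable_iteri (G := fun x i H => G (e x) i H :: H)) => //; last first.
  exact: computable_const.
apply: computable_cons; last by apply: computable_snd; apply: computable_id.
apply: (computable_comp (g := fun q : E * nat * seq nat => G q.1.1 q.1.2 q.2)
  (f := fun q : E' * nat * seq nat => (e q.1.1, q.1.2, q.2))) => //.
apply: computable_pair; last by apply: computable_snd; apply: computable_id.
apply: computable_pair.
  apply: computable_comp Ce _.
  by do 2! apply: computable_fst; apply: computable_id.
by apply: computable_snd; apply: computable_fst; apply: computable_id.
Qed.

End CourseOfValues.

Section ComputableSeq.
Context (E A B : Type) {eE : encodable E} {eA : encodable A} {eB : encodable B}.

(** Folding is course-of-values recursion on the code of the list, because the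
    code of the tail is smaller. *)
Lemma computable_foldr (g : E -> A -> B -> B) (z : E -> B) (s : E -> seq A) :
  computable (fun q : E * A * B => g q.1.1 q.1.2 q.2) ->
  computable z -> computable s ->
  computable (fun e => foldr (g e) (z e) (s e)).
Proof.
move=> [g' Rg gE] [z' Rz zE] [s' Rs sE].
pose G e c H := if c == 0 then z' e else
  g' (consn (consn e (headn c)) (nth 0 H (c - (tailn c).+1))).
have [h Rh hE] : computable (fun x : nat => covrec G x (s' x)).
  apply: (computable_covrec (e := id)); last by exists s'.
    have Cfst : computable (fun q : nat * nat * seq nat => q.1.1).
      by do 2! apply: computable_fst; apply: computable_id.
    have Csnd : computable (fun q : nat * nat * seq nat => q.1.2).
      by apply: computable_snd; apply: computable_fst; apply: computable_id.
    apply: computable_if; last 1 first.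
    - apply: (computable_rec1 Rg); apply: (computable_rec2 recursive2_cons).
        apply: (computable_rec2 recursive2_cons) => //.
        exact: (computable_rec1 recursive1_head).
      apply: computable_nth; first by apply: computable_snd; apply: computable_id.
      apply: computable_sub => //; apply: computable_succ.
      exact: (computable_rec1 recursive1_tail).
    - by apply: computable_eqn => //; apply: computable_const.
    - exact: (computable_rec1 Rz).
  exact: computable_id.
exists h => // e; rewrite (hE (encode e)) -[LHS]/(covrec G (encode e) (s' (encode e))).
rewrite sE; elim: (s e) => [|a t IHt]; first by rewrite -zE.
rewrite encode_cons /covrec {1}/G.
have c_gt0 : 0 < consn (encode a) (encode t).
  by rewrite /consn muln_gt0 expn_gt0.
rewrite eqn0Ngt c_gt0 headn_cons tailn_cons nth_history.
  by rewrite IHt -(gE (e, a, _)).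
have a_gt0 : 0 < 2 ^ encode a by rewrite expn_gt0.
by rewrite /consn; nia.
Qed.

End ComputableSeq.

(** Projections out of a nested environment.  A single projection comes out of
    the preceding [apply:] eta-contracted and is expanded by hand. *)
Ltac comp_var :=
  repeat lazymatch goal with
  | |- computable (fun e => e) => exact: computable_id
  | |- computable fst => refine (@computable_fst _ _ _ _ _ _ (fun e => e) _)
  | |- computable snd => refine (@computable_snd _ _ _ _ _ _ (fun e => e) _)
  | |- computable (fun e => _.1) => apply: computable_fst
  | |- computable (fun e => _.2) => apply: computable_snd
  end.

Section ComputableSeqNat.
Context (E A B : Type) {eE : encodable E} {eA : encodable A} {eB : encodable B}.

Lemma computable_map (f : E -> A -> B) (s : E -> seq A) :
  computable (fun q : E * A => f q.1 q.2) -> computable s ->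
  computable (fun e => map (f e) (s e)).
Proof.
move=> Cf Cs.
apply: (computable_ext (f := fun e => foldr (fun a r => f e a :: r) [::] (s e))).
  by move=> e; elim: (s e) => //= a t ->.
apply: (computable_foldr (g := fun e a r => f e a :: r)) => //; last first.
  exact: computable_const.
apply: computable_cons; last by comp_var.
apply: (computable_comp (f := fun q : E * A * seq B => q.1) Cf); comp_var.
Qed.

Lemma computable_cat (s t : E -> seq A) :
  computable s -> computable t -> computable (fun e => s e ++ t e).
Proof.
move=> Cs Ct.
apply: (computable_ext (f := fun e => foldr cons (t e) (s e))).
  by move=> e; elim: (s e) => //= a u ->.
apply: (computable_foldr (g := fun=> cons)) => //.
by apply: computable_cons; comp_var.
Qed.

Lemma computable_filter (p : E -> A -> bool) (s : E -> seq A) :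
  computable (fun q : E * A => p q.1 q.2) -> computable s ->
  computable (fun e => filter (p e) (s e)).
Proof.
move=> Cp Cs.
apply: (computable_ext (f := fun e =>
    foldr (fun a r => if p e a then a :: r else r) [::] (s e))).
  by move=> e; elim: (s e) => //= a t ->.
apply: (computable_foldr (g := fun e a r => if p e a then a :: r else r)) => //.
  apply: computable_if; [|apply: computable_cons; comp_var|comp_var].
  apply: (computable_comp (f := fun q : E * A * seq A => q.1) Cp); comp_var.
exact: computable_const.
Qed.

Lemma computable_all (p : E -> A -> bool) (s : E -> seq A) :
  computable (fun q : E * A => p q.1 q.2) -> computable s ->
  computable (fun e => all (p e) (s e)).
Proof.
move=> Cp Cs.
apply: (computable_ext (f := fun e => foldr (fun a r => p e a && r) true (s e))).
  by move=> e; elim: (s e) => //= a t ->.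
apply: (computable_foldr (g := fun e a r => p e a && r)) => //.
  apply: computable_and; last by comp_var.
  apply: (computable_comp (f := fun q : E * A * bool => q.1) Cp); comp_var.
exact: computable_const.
Qed.

Lemma computable_mem (c : E -> nat) (s : E -> seq nat) :
  computable c -> computable s -> computable (fun e => c e \in s e).
Proof.
move=> Cc Cs.
apply: (computable_ext (f := fun e => foldr (fun a r => (c e == a) || r) false (s e))).
  by move=> e; elim: (s e) => //= a t ->; rewrite in_cons.
apply: (computable_foldr (g := fun e a r => (c e == a) || r)) => //.
  apply: computable_or; last by comp_var.
  apply: computable_eqn; last by comp_var.
  apply: computable_comp Cc _; comp_var.
exact: computable_const.
Qed.

End ComputableSeqNat.

Section ComputableLists.
Context (E A : Type) {eE : encodable E} {eA : encodable A}.

Lemma computable_flatten (s : E -> seq (seq A)) :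
  computable s -> computable (fun e => flatten (s e)).
Proof.
move=> Cs; apply: (computable_foldr (g := fun=> cat)) => //.
  by apply: computable_cat; comp_var.
exact: computable_const.
Qed.

Lemma computable_size (s : E -> seq A) :
  computable s -> computable (fun e => size (s e)).
Proof.
move=> Cs; apply: (computable_ext (f := fun e => foldr (fun=> succn) 0 (s e))).
  by move=> e; elim: (s e) => //= a t ->.
apply: (computable_foldr (g := fun=> fun=> succn)) => //.
  by apply: computable_succ; comp_var.
exact: computable_const.
Qed.

Lemma computable_iota (n : E -> nat) :
  computable n -> computable (fun e => iota 0 (n e)).
Proof.
move=> Cn.
apply: (computable_ext (f := fun e => iteri (n e) (fun i r => r ++ [:: i]) [::])).
  by move=> e; elim: (n e) => // k IHk; rewrite -[k.+1]addn1 iotaD -IHk addn1.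
apply: (computable_iteri (G := fun _ i r => r ++ [:: i])) => //.
  apply: computable_cat; first by comp_var.
  by apply: computable_cons; [comp_var | exact: computable_const].
exact: computable_const.
Qed.

End ComputableLists.

(** Computability is proved by following the syntax of the function; a binder
    extends the environment [e] to a pair. *)
Ltac comp_step :=
  lazymatch goal with
  | |- computable (fun e => e) => exact: computable_id
  | |- computable fst => refine (@computable_fst _ _ _ _ _ _ (fun e => e) _)
  | |- computable snd => refine (@computable_snd _ _ _ _ _ _ (fun e => e) _)
  | |- computable (fun e => _.1) => apply: computable_fst
  | |- computable (fun e => _.2) => apply: computable_snd
  | |- computable (fun e => (_, _)) => apply: computable_pair
  | |- computable (fun e => if _ then _ else _) => apply: computable_if
  | |- computable (fun e => ~~ _) => apply: computable_neg
  | |- computable (fun e => _ && _) => apply: computable_and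
  | |- computable (fun e => _ || _) => apply: computable_or
  | |- computable (fun e => _ ==> _) => apply: computable_imp
  | |- computable (fun e => nat_of_bool _) => apply: computable_nat_of_bool
  | |- computable (fun e => _.+1) => apply: computable_succ
  | |- computable (fun e => _ - _) => apply: computable_sub
  | |- computable (fun e => _ == _) => apply: computable_eqn
  | |- computable (fun e => CodeSeq.code _) => apply: computable_code
  | |- computable (fun e => CodeSeq.decode _) => apply: computable_decode
  | |- computable (fun e => head 0 _) => apply: computable_head
  | |- computable (fun e => nth 0 _ _) => apply: computable_nth
  | |- computable (fun e => behead _) => apply: computable_behead
  | |- computable (fun e => _ :: _) => apply: computable_cons
  | |- computable (fun e => _ ++ _) => apply: computable_cat
  | |- computable (fun e => flatten _) => apply: computable_flatten
  | |- computable (fun e => size _) => apply: computable_size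
  | |- computable (fun e => iota 0 _) => apply: computable_iota
  | |- computable (fun e => _ \in _) => apply: computable_mem
  | |- computable (fun e => map (@?f e) _) => apply: (computable_map (f := f))
  | |- computable (fun e => filter (@?p e) _) => apply: (computable_filter (p := p))
  | |- computable (fun e => all (@?p e) _) => apply: (computable_all (p := p))
  | |- computable (fun _ => ?c) => exact: computable_const
  end.

Ltac comp :=
  repeat (first
    [comp_step
    |assumption
    |match goal with H : computable ?f |- computable (fun e => ?f (@?g e)) =>
       apply: (computable_comp (g := f) (f := g) H) end];
    rewrite /=).

Section Enumerations.

Fixpoint sublists A (s : seq A) : seq (seq A) :=
  if s is x :: s' then sublists s' ++ map (cons x) (sublists s') else [:: [::]].

Lemma filter_sublists (p : pred nat) s : filter p s \in sublists s.
Proof.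
elim: s => //= x s IHs; rewrite mem_cat; case: ifP => _; last by rewrite IHs.
by rewrite map_f ?orbT.
Qed.

Lemma sublists_sub (s t : seq nat) : t \in sublists s -> {subset t <= s}.
Proof.
elim: s t => /= [|x s IHs] t; first by rewrite inE => /eqP->.
rewrite mem_cat => /orP[/IHs sub_ts c /sub_ts|/mapP[u /IHs sub_us ->] c].
  by rewrite inE orbC => ->.
by rewrite !inE => /orP[->//|/sub_us->]; rewrite orbT.
Qed.

Definition lists_below m k : seq (seq nat) :=
  iteri k (fun _ r => flatten [seq [seq x :: s | s <- r] | x <- iota 0 m]) [:: [::]].

Lemma mem_lists_below m k s :
  (s \in lists_below m k) = (size s == k) && all (ltn^~ m) s.
Proof.
elim: k s => [|k IHk] [|x s] //=.
  by apply/negbTE/flattenP => -[_ /mapP[x _ ->] /mapP[]].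
rewrite eqSS; apply/flattenP/idP => [[_ /mapP[y +  ->] /mapP[u + [-> ->]]]|].
  by rewrite mem_iota IHk => /= -> /andP[-> ->].
case/and3P => sz ltx lts; exists [seq x :: u | u <- lists_below m k].
  by apply: map_f; rewrite mem_iota.
by apply: map_f; rewrite IHk sz.
Qed.

Context (E : Type) {eE : encodable E}.

Lemma computable_sublists (s : E -> seq nat) :
  computable s -> computable (fun e => sublists (s e)).
Proof.
move=> Cs.
apply: (computable_ext (f := fun e =>
    foldr (fun x r => r ++ map (cons x) r) [:: [::]] (s e))).
  by move=> e; elim: (s e) => //= x t ->.
apply: (computable_foldr (g := fun _ x r => r ++ map (cons x) r)) => //; comp.
Qed.

Lemma computable_lists_below (m k : E -> nat) :
  computable m -> computable k -> computable (fun e => lists_below (m e) (k e)).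
Proof.
move=> Cm Ck.
apply: (computable_iteri (G := fun e _ r =>
  flatten [seq [seq x :: s | s <- r] | x <- iota 0 (m e)])) => //; comp.
Qed.

End Enumerations.

(** * Evaluation of coded formulas in finite structures *)

(** The size of the domain, a list of facts and a list of values of the
    variables. *)
Notation env := (nat * seq nat * seq nat)%type.

Section Checker.

(** The default 0 is irrelevant for lists of facts of a structure, where there is
    exactly one value ([fact_values]). *)
Definition lookup (m : nat) (s : seq nat) (f : nat) (args : seq nat) :=
  head 0 [seq y <- iota 0 m | CodeSeq.code [:: 0, f, y & args] \in s].

(** [n] is the code of a term, and [H] lists the values of all smaller codes, in
    particular of the codes of its immediate subterms. *)
Definition eval_step (e : env) (n : nat) (H : seq nat) : nat :=
  if nth 0 (CodeSeq.decode n) 0 == 0 then nth 0 e.2 (nth 0 (CodeSeq.decode n) 1)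
  else lookup e.1.1 e.1.2 (nth 0 (CodeSeq.decode n) 1)
    [seq nth 0 H (n - j.+1) | j <- behead (behead (CodeSeq.decode n))].

Definition eval_code : env -> nat -> nat := covrec eval_step.

(** Truth values are represented by 0 and 1. *)
Definition sat_step (e : env) (n : nat) (H : seq nat) : nat :=
  let w := CodeSeq.decode n in
  let x i := nth 0 H (n - (nth 0 w i).+1) in
  let y i := eval_code e (nth 0 w i) in
  if nth 0 w 0 == 0 then false
  else if nth 0 w 0 == 1 then (x 1 == 1) ==> (x 2 == 1)
  else if nth 0 w 0 == 2 then y 1 == y 2
  else if nth 0 w 0 == 3 then CodeSeq.code [:: 2; y 1; y 2] \in e.1.2
  else CodeSeq.code [:: 1, nth 0 w 1 & map (eval_code e) (behead (behead w))]
    \in e.1.2.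

Definition sat_code e n := covrec sat_step e n == 1.

(** The indices of the variables of a formula are smaller than its code [c], so
    valuations of the first [c.+1] variables suffice. *)
Definition holds_code m s c :=
  all (fun vs => sat_code (m, s, vs) c) (lists_below m c.+1).

Context (E : Type) {eE : encodable E}.

Lemma computable_eval_code (e : E -> env) (n : E -> nat) :
  computable e -> computable n -> computable (fun x => eval_code (e x) (n x)).
Proof.
apply: computable_covrec; rewrite /eval_step /lookup /=; comp.
Qed.

End Checker.

Lemma computable_sat_code (E : Type) (eE : encodable E) (e : E -> env) (n : E -> nat) :
  computable e -> computable n -> computable (fun x => sat_code (e x) (n x)).
Proof.
move=> Ce Cn; apply: computable_eqn; last exact: computable_const.
apply: (computable_covrec _ Ce Cn); rewrite /sat_step /=.
by comp; apply: computable_eval_code; comp.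
Qed.

Lemma computable_holds_code (E : Type) (eE : encodable E)
    (m : E -> nat) (s : E -> seq nat) (c : E -> nat) :
  computable m -> computable s -> computable c ->
  computable (fun x => holds_code (m x) (s x) (c x)).
Proof.
move=> Cm Cs Cc; apply: (computable_all
  (p := fun x vs => sat_code (m x, s x, vs) (c x))).
  by apply: computable_sat_code; comp.
by apply: computable_lists_below => //; comp.
Qed.

Lemma lt_code_mem s j : j \in s -> j < CodeSeq.code s.
Proof. by apply: (allP (CodeSeq.ltn_code s)). Qed.

Lemma eval_code_var e k : eval_code e (CodeSeq.code [:: 0; k]) = nth 0 e.2 k.
Proof. by rewrite /eval_code /covrec {1}/eval_step CodeSeq.codeK. Qed.

Lemma eval_code_app e f args :
  eval_code e (CodeSeq.code [:: 1, f & args]) =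
  lookup e.1.1 e.1.2 f (map (eval_code e) args).
Proof.
set n := CodeSeq.code _; have En : CodeSeq.decode n = [:: 1, f & args].
  exact: CodeSeq.codeK.
have Hn j : j \in args -> nth 0 (history eval_step e n) (n - j.+1) = eval_code e j.
  by move=> argsj; rewrite nth_history // lt_code_mem // !inE argsj !orbT.
rewrite {1}/eval_code /covrec; move: (history _ e n) Hn => H Hn.
rewrite /eval_step En /=; congr lookup; exact/eq_in_map.
Qed.

Lemma sat_code_bot e : sat_code e (CodeSeq.code [:: 0]) = false.
Proof. by rewrite /sat_code /covrec /sat_step CodeSeq.codeK. Qed.

Lemma sat_code_imp e p q :
  sat_code e (CodeSeq.code [:: 1; p; q]) = sat_code e p ==> sat_code e q.
Proof.
set n := CodeSeq.code _; have En : CodeSeq.decode n = [:: 1; p; q].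
  exact: CodeSeq.codeK.
have Hn j : j \in [:: p; q] ->
    (nth 0 (history sat_step e n) (n - j.+1) == 1) = sat_code e j.
  by move=> pqj; rewrite nth_history // lt_code_mem // inE pqj orbT.
rewrite {1}/sat_code /covrec; move: (history _ e n) Hn => H Hn.
by rewrite /sat_step En /= eqb1 !Hn // !inE eqxx ?orbT.
Qed.

Lemma sat_code_eq e t u :
  sat_code e (CodeSeq.code [:: 2; t; u]) = (eval_code e t == eval_code e u).
Proof. by rewrite /sat_code /covrec /sat_step CodeSeq.codeK /= eqb1. Qed.

Lemma sat_code_le e t u :
  sat_code e (CodeSeq.code [:: 3; t; u]) =
  (CodeSeq.code [:: 2; eval_code e t; eval_code e u] \in e.1.2).
Proof. by rewrite /sat_code /covrec /sat_step CodeSeq.codeK /= eqb1. Qed.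

Lemma sat_code_rel e r args :
  sat_code e (CodeSeq.code [:: 4, r & args]) =
  (CodeSeq.code [:: 1, r & map (eval_code e) args] \in e.1.2).
Proof. by rewrite /sat_code /covrec /sat_step CodeSeq.codeK /= eqb1. Qed.

Section CheckerCorrect.
Variables (L : language) (cf : funsym L -> nat) (cr : relsym L -> nat).
Hypotheses (inj_cf : injective cf) (inj_cr : injective cr).

Lemma map_enum_inj n (a b : 'I_n -> nat) :
  [seq a i | i <- enum 'I_n] = [seq b i | i <- enum 'I_n] -> a = b.
Proof.
by move=> /eq_in_map E; apply: funext => i; apply: E; rewrite mem_enum.
Qed.

Lemma nat_of_ord_fun_inj m n (a b : 'I_n -> 'I_m) :
  [seq nat_of_ord (a i) | i <- enum 'I_n] = [seq nat_of_ord (b i) | i <- enum 'I_n] ->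
  a = b.
Proof.
move=> /map_enum_inj E; apply: funext => i; apply: val_inj.
exact: (congr1 (@^~ i) E).
Qed.

Variables (m : nat) (I : interp L 'I_m) (s : seq nat).

Lemma fact_funE f (a : 'I_(funar f) -> 'I_m) y :
  fact cf cr I (CodeSeq.code
      [:: 0, cf f, y & [seq nat_of_ord (a i) | i <- enum 'I_(funar f)]]) <->
  y = fint I a.
Proof.
split=> [|->]; last exact: fact_fun.
set c := CodeSeq.code _; move Ec: c => c' Hc; case: c' / Hc Ec => [f' a'|r b _|x z _];
  rewrite /c => /(can_inj CodeSeq.codeK) // [/inj_cf].
by move=> Ef; subst f' => -> /nat_of_ord_fun_inj ->.
Qed.

Lemma fact_relE r (a : 'I_(relar r) -> 'I_m) :
  fact cf cr I (CodeSeq.code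
      [:: 1, cr r & [seq nat_of_ord (a i) | i <- enum 'I_(relar r)]]) <->
  rint I a.
Proof.
split=> [|Ia]; last exact: fact_rel.
set c := CodeSeq.code _; move Ec: c => c' Hc; case: c' / Hc Ec => [f' a'|r' b Ib|x z _];
  rewrite /c => /(can_inj CodeSeq.codeK) // [/inj_cr].
by move=> Er; subst r' => /nat_of_ord_fun_inj ->.
Qed.

Lemma fact_leE (x y : 'I_m) :
  fact cf cr I (CodeSeq.code [:: 2; nat_of_ord x; nat_of_ord y]) <-> leint I x y.
Proof.
split=> [|Ia]; last exact: fact_le.
set c := CodeSeq.code _; move Ec: c => c' Hc.
case: c' / Hc Ec => [f' a'|r' b Ib|x' y' xy]; rewrite /c => /(can_inj CodeSeq.codeK) //.
by case=> /val_inj -> /val_inj ->.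
Qed.

Hypothesis sP : forall c, c \in s <-> fact cf cr I c.

Lemma fact_values f (a : 'I_(funar f) -> 'I_m) :
  [seq y <- iota 0 m | CodeSeq.code
    [:: 0, cf f, y & [seq nat_of_ord (a i) | i <- enum 'I_(funar f)]] \in s] =
  [:: nat_of_ord (fint I a)].
Proof.
have /(filter_pred1_uniq (iota_uniq 0 m)) <- : nat_of_ord (fint I a) \in iota 0 m.
  by rewrite mem_iota /=.
apply: eq_in_filter => y; rewrite mem_iota => ltym /=.
apply/idP/eqP => [/sP|->]; last exact/sP/fact_funE.
by rewrite -[y]/(val (Ordinal ltym)) => /fact_funE ->.
Qed.

Lemma lookupE f (a : 'I_(funar f) -> 'I_m) :
  lookup m s (cf f) [seq nat_of_ord (a i) | i <- enum 'I_(funar f)] = fint I a.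
Proof. by rewrite /lookup fact_values. Qed.

Variables (v : nat -> 'I_m) (vs : seq nat) (b : nat).
Hypothesis vsE : forall k, k < b -> nth 0 vs k = v k.

(** [b] bounds the code of the whole formula, hence the indices of the variables
    that matter. *)
Lemma eval_codeE t : term_code cf t <= b ->
  eval_code (m, s, vs) (term_code cf t) = eval I v t.
Proof.
elim: t => [k|f ts IHt] leb.
  rewrite eval_code_var vsE //; apply: leq_trans leb.
  by rewrite lt_code_mem // !inE eqxx orbT.
rewrite eval_code_app -map_comp -lookupE; congr lookup; apply/eq_in_map => i _.
apply: IHt; apply: leq_trans leb; rewrite ltnW //.
by rewrite lt_code_mem // !inE map_f ?orbT // mem_enum.
Qed.

Lemma sat_codeE p : qf_code cf cr p <= b ->
  sat_code (m, s, vs) (qf_code cf cr p) <-> sat I v p.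
Proof.
have le_mem c l : CodeSeq.code l <= b -> c \in l -> c <= b.
  by move=> leb lc; apply: leq_trans leb; rewrite ltnW // lt_code_mem.
have le_nth i l : CodeSeq.code l <= b -> i < size l -> nth 0 l i <= b.
  by move=> leb ltil; apply: le_mem leb _; apply: mem_nth.
elim: p => [|p IHp q IHq|t u|t u|r ts] leb.
- by rewrite sat_code_bot.
- have {}IHp := IHp (le_nth 1 _ leb isT).
  have {}IHq := IHq (le_nth 2 _ leb isT).
  rewrite sat_code_imp; split=> [/implyP pq /IHp/pq/IHq //|pq].
  by apply/implyP => /IHp/pq/IHq.
- have /eval_codeE Et := le_nth 1 _ leb isT.
  have /eval_codeE Eu := le_nth 2 _ leb isT.
  by rewrite sat_code_eq Et Eu; split=> [/eqP/val_inj|/= ->].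
- have /eval_codeE Et := le_nth 1 _ leb isT.
  have /eval_codeE Eu := le_nth 2 _ leb isT.
  by rewrite sat_code_le Et Eu; apply: iff_trans (fact_leE _ _); apply: sP.
rewrite sat_code_rel -map_comp -[sat _ _ _]/(rint I (fun i => eval I v (ts i))).
apply: iff_trans (fact_relE _); apply: iff_trans (sP _).
suff -> : map (eval_code (m, s, vs) \o (fun i => term_code cf (ts i)))
    (enum 'I_(relar r)) =
  [seq nat_of_ord (eval I v (ts i)) | i <- enum 'I_(relar r)] by [].
apply/eq_in_map => i _; apply: eval_codeE; apply: (le_mem _ _ leb).
by rewrite !inE map_f ?orbT // mem_enum.
Qed.

End CheckerCorrect.

Lemma holds_codeE (L : language) (cf : funsym L -> nat) (cr : relsym L -> nat) m
    (I : interp L 'I_m) s p :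
  injective cf -> injective cr -> 0 < m ->
  (forall c, c \in s <-> fact cf cr I c) ->
  holds_code m s (qf_code cf cr p) <-> holds I p.
Proof.
move=> icf icr m_gt0 sP; set c := qf_code _ _ _; split=> [/allP all_p v|Ip].
  pose vs := [seq nat_of_ord (v k) | k <- iota 0 c.+1].
  apply/(sat_codeE icf icr sP (vs := vs) (b := c)) => //.
    by move=> k ltk; rewrite /vs (nth_map 0) ?size_iota ?nth_iota // ltnW.
  apply: all_p; rewrite mem_lists_below size_map size_iota eqxx.
  by apply/allP => _ /mapP[k _ ->] /=.
apply/allP => vs; rewrite mem_lists_below => /andP[/eqP sz_vs /allP vs_lt].
pose v k := insubd (Ordinal m_gt0) (nth 0 vs k).
apply/(sat_codeE icf icr sP (v := v) (b := c)) => // k ltk.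
rewrite val_insubd ifT //; apply: vs_lt.
by rewrite mem_nth // sz_vs ltnW.
Qed.

(** * Finite structures as lists of facts *)

(** The structure is pulled back along a bijection. *)
Lemma transport_ordinal (L : language) M (IM : interp L M) m (g : 'I_m -> M) :
  injective g -> (forall y, exists i, g i = y) ->
  exists I : interp L 'I_m, forall p, holds I p <-> holds IM p.
Proof.
move=> g_inj /choice[h hK].
pose I := @Interp L 'I_m (fun f a => h (fint IM (f := f) (g \o a)))
  (fun r a => rint IM (r := r) (g \o a)) (fun x y => leint IM (g x) (g y)).
have satE v p : sat I v p <-> sat IM (g \o v) p 
  by apply: (sat_embedding (e := g)) => // f a; rewrite hK.
exists I => p; split=> [Ip v|Mp v]; last exact/satE.
have -> : v = g \o (h \o v) by apply: funext => k /=; rewrite hK.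
exact/satE.
Qed.

Section FactLists.
Variables (funs rels : seq (nat * nat)).

(** [funs] and [rels] list the codes of the symbols with their arities. *)
Definition functional (m : nat) (s : seq nat) :=
  all (fun q => all (fun a =>
      size [seq y <- iota 0 m | CodeSeq.code [:: 0, q.1, y & a] \in s] == 1)
    (lists_below m q.2)) funs.

Definition possible_facts m :=
  flatten [seq flatten [seq [seq CodeSeq.code [:: 0, q.1, y & a] | y <- iota 0 m]
                       | a <- lists_below m q.2] | q <- funs] ++
  (flatten [seq [seq CodeSeq.code [:: 1, q.1 & a] | a <- lists_below m q.2]
           | q <- rels] ++
   [seq CodeSeq.code (2 :: a) | a <- lists_below m 2]).

Context (E : Type) {eE : encodable E}.

Lemma computable_functional (m : E -> nat) (s : E -> seq nat) :
  computable m -> computable s -> computable (fun e => functional (m e) (s e)).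
Proof.
move=> Cm Cs; rewrite /functional; comp.
by apply: computable_lists_below; comp.
Qed.

Lemma computable_possible_facts (m : E -> nat) :
  computable m -> computable (fun e => possible_facts (m e)).
Proof.
move=> Cm; rewrite /possible_facts; comp.
all: by apply: computable_lists_below; comp.
Qed.

End FactLists.

Lemma lists_belowP m k a : 0 < m ->
  reflect (exists a' : 'I_k -> 'I_m, a = [seq nat_of_ord (a' i) | i <- enum 'I_k])
    (a \in lists_below m k).
Proof.
move=> m_gt0; rewrite mem_lists_below.
apply: (iffP andP) => [[/eqP sz_a /allP lta]|[a' ->]]; last first.
  by rewrite size_map size_enum_ord; split=> //; apply/allP => _ /mapP[i _ ->] /=.
exists (fun i => insubd (Ordinal m_gt0) (nth 0 a i)).
apply: (@eq_from_nth _ 0); first by rewrite size_map size_enum_ord.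
rewrite sz_a => i ltik.
rewrite (nth_map (Ordinal ltik)) ?size_enum_ord // val_insubd nth_enum_ord //.
by rewrite ifT //; apply: lta; rewrite mem_nth ?sz_a.
Qed.

Section FactsOfStructure.
Variables (L : language) (cf : funsym L -> nat) (cr : relsym L -> nat).
Hypotheses (inj_cf : injective cf) (inj_cr : injective cr).
Variables (nf nr : nat) (gf : 'I_nf -> funsym L) (gr : 'I_nr -> relsym L).
Hypotheses (gf_surj : forall f, exists i, gf i = f).
Hypotheses (gr_surj : forall r, exists i, gr i = r).
Variable m : nat.
Hypothesis m_gt0 : 0 < m.

Let funs := [seq (cf (gf i), funar (gf i)) | i <- enum 'I_nf].
Let rels := [seq (cr (gr i), relar (gr i)) | i <- enum 'I_nr].

Lemma mem_funs f : (cf f, funar f) \in funs.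
Proof.
by have [i <-] := gf_surj f; apply: (map_f (fun i => (_, _))); rewrite mem_enum.
Qed.

Lemma mem_rels r : (cr r, relar r) \in rels.
Proof.
by have [i <-] := gr_surj r; apply: (map_f (fun i => (_, _))); rewrite mem_enum.
Qed.

Lemma facts_possible (I : interp L 'I_m) c :
  fact cf cr I c -> c \in possible_facts funs rels m.
Proof.
case=> {c} [f a|r a _|x y _]; rewrite !mem_cat.
- apply/orP; left; apply/flattenP; eexists; first exact: map_f (mem_funs f).
  apply/flattenP; eexists.
    by apply: map_f; apply/lists_belowP => //; exists a.
  by apply: (map_f (fun y => CodeSeq.code [:: 0, _, y & _])); rewrite mem_iota /=.
- apply/orP; right; apply/orP; left; apply/flattenP; eexists.
    exact: map_f (mem_rels r).
  apply: (map_f (fun a => CodeSeq.code [:: 1, _ & a])).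
  by apply/lists_belowP => //; exists a.
apply/orP; right; apply/orP; right.
apply: (map_f (fun a => CodeSeq.code (2 :: a))).
by rewrite mem_lists_below /= !ltn_ord.
Qed.

(** Completeness of the search. *)
Lemma facts_of_structure (I : interp L 'I_m) :
  exists2 s, s \in sublists (possible_facts funs rels m) &
    forall c, c \in s <-> fact cf cr I c.
Proof.
exists [seq c <- possible_facts funs rels m | `[< fact cf cr I c >]].
  exact: filter_sublists.
move=> c; rewrite mem_filter; split=> [/andP[/asboolP]//|Ic].
by apply/andP; split; [apply/asboolP | apply: facts_possible Ic].
Qed.

Lemma functional_facts (I : interp L 'I_m) s :
  (forall c, c \in s <-> fact cf cr I c) -> functional funs m s.
Proof.
move=> sP; apply/allP => _ /mapP[i _ ->] /=; apply/allP => _ /lists_belowP[] // a ->.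
by rewrite (fact_values inj_cf sP).
Qed.

(** Soundness of the search: nothing has to be tested about relations and the
    order, because every set of such facts is possible. *)
Lemma structure_of_facts s :
  s \in sublists (possible_facts funs rels m) -> functional funs m s ->
  exists I : interp L 'I_m, forall c, c \in s <-> fact cf cr I c.
Proof.
move=> /sublists_sub s_sub s_fun.
pose args n (a : 'I_n -> 'I_m) := [seq nat_of_ord (a i) | i <- enum 'I_n].
pose fcode f (a : 'I_(funar f) -> 'I_m) (y : nat) :=
  CodeSeq.code [:: 0, cf f, y & args _ a].
have values f (a : 'I_(funar f) -> 'I_m) : exists z : 'I_m,
    [seq y <- iota 0 m | fcode f a y \in s] = [:: nat_of_ord z].
  have := allP (allP s_fun _ (mem_funs f)) (args _ a).
  have -> : args _ a \in lists_below m (funar f) by apply/lists_belowP => //; exists a.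
  move=> /(_ isT); rewrite -/(fcode f a _).
  set l := filter _ _ => /eqP sz_l.
  have : {subset l <= iota 0 m} by move=> y; rewrite mem_filter => /andP[].
  case: l sz_l => [|z []] // _ /(_ z (mem_head _ _)); rewrite mem_iota => ltzm.
  by exists (Ordinal ltzm).
pose I := @Interp L 'I_m (fun f a => sval (cid (values f a)))
  (fun r a => CodeSeq.code [:: 1, cr r & args _ a] \in s)
  (fun x y => CodeSeq.code [:: 2; nat_of_ord x; nat_of_ord y] \in s).
have fintE f (a : 'I_(funar f) -> 'I_m) (y : 'I_m) :
    (fcode f a y \in s) = (y == fint I a).
  have Ey : (nat_of_ord y \in [seq z <- iota 0 m | fcode f a z \in s]) =
      (fcode f a y \in s).
    by rewrite mem_filter mem_iota /= ltn_ord andbT.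
  by rewrite -Ey (svalP (cid (values f a))) inE.
exists I => c; split=> [sc|[f a|r a|x y]] //; last by rewrite -/(fcode f a _) fintE.
have := sc; move/s_sub: sc; rewrite !mem_cat => /or3P[].
- move=> /flattenP[_ /mapP[_ /mapP[i _ ->] ->]].
  move=> /flattenP[_ /mapP[_ /(lists_belowP _ _ m_gt0)[a ->] ->]] /mapP[y].
  rewrite mem_iota => ltym ->; rewrite -[y]/(nat_of_ord (Ordinal ltym)).
  by rewrite -/(fcode (gf i) a _) fintE => /eqP ->; apply: fact_fun.
- move=> /flattenP[_ /mapP[_ /mapP[i _ ->] ->]].
  move=> /mapP[_ /(lists_belowP _ _ m_gt0)[a ->] ->] sc.
  exact: fact_rel.
move=> /mapP[_ /(lists_belowP _ _ m_gt0)[a ->] ->].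
by rewrite !enum_ordSl enum_ord0 => sc; apply: fact_le.
Qed.

End FactsOfStructure.

(** * The decision procedure *)

Section Decision.
Variables (funs rels : seq (nat * nat)) (new_codes axiom_codes : seq nat).
Variables (d : nat -> nat -> nat) (hT : nat -> nat).

(** The tag 0 marks the facts about function symbols.  The given algorithm for [T]
    expects only facts in the old language. *)
Definition old_fact c :=
  ~~ ((nth 0 (CodeSeq.decode c) 0 == 0) &&
      (nth 0 (CodeSeq.decode c) 1 \in new_codes)).

Definition finite_model (m : nat) (s : seq nat) :=
  [&& functional funs m s, d m (CodeSeq.code [seq c <- s | old_fact c]) == 1 &
      all (holds_code m s) axiom_codes].

(** The domain has size [k.+1], since it must not be empty. *)
Definition entails_code (c : nat) :=
  all (fun k => all (fun s => finite_model k.+1 s ==> holds_code k.+1 s c)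
      (sublists (possible_facts funs rels k.+1)))
    (iota 0 (hT c.+1)).

Lemma recursive_entails_code : recursive2 d -> recursive1 hT ->
  recursive1 (fun c => nat_of_bool (entails_code c)).
Proof.
move=> Rd RhT.
suff [g Rg gE] : @computable _ _ encodable_nat encodable_bool entails_code.
  by apply: (recursive_ext _ Rg) => x; apply: (gE (thead x)).
rewrite /entails_code /finite_model /old_fact; comp.
- by apply: computable_functional; comp.
- by apply: (computable_rec2 Rd); comp.
- by apply: computable_holds_code; comp.
- by apply: computable_holds_code; comp.
- by apply: computable_sublists; apply: computable_possible_facts; comp.
by apply: (computable_rec1 RhT); exists succn => //; apply: recursive1_succ.
Qed.

End Decision.

Section DecisionCorrect.
Variables (L : language) (T : theory L) (I : Type) (W : I -> property L).
Local Notation L' := (expansion W).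
Hypothesis leT : order_axioms L `<=` consequences T.
Hypothesis HW : forall k, admissible T (W k).
Variables (cf : funsym L' -> nat) (cr : relsym L' -> nat).
Hypotheses (inj_cf : injective cf) (inj_cr : injective cr).
Hypothesis finL' : finite_language L'.

(** In a finite language there are finitely many new operations, each with
    finitely many axioms; so the search can test the axioms one by one. *)
Lemma finite_axioms :
  finite_set (\bigcup_(k in [set: I]) axioms (L' := L') inl (inr k) (W k)).
Proof.
apply: bigcup_finite => [|k _].
  have /(finite_preimage _) : finite_set [set: funsym L'] by case: finL'.
  by move=> /(_ I inr)H; apply: (sub_finite_set _ (H _)) => // x y _ _ [].
case: (W k) => *; rewrite /axioms /ax_monotone; rewrite ?finite_setU;
  repeat split; try exact: finite_set1; try (apply: finite_image; exact: finite_finset).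
exact: finite_image (finite_II _).
Qed.

Variables (nf nr : nat) (gf : 'I_nf -> funsym L') (gr : 'I_nr -> relsym L').
Hypotheses (gf_surj : forall f, exists i, gf i = f).
Hypotheses (gr_surj : forall r, exists i, gr i = r).

Let funs := [seq (cf (gf i), funar (gf i)) | i <- enum 'I_nf].
Let rels := [seq (cr (gr i), relar (gr i)) | i <- enum 'I_nr].
Let new_codes :=
  [seq cf (gf i) | i <- enum 'I_nf & if gf i is inr _ then true else false].

Lemma mem_new_codes f :
  (cf f \in new_codes) = if f is inr _ then true else false.
Proof.
apply/mapP/idP => [[i +  /inj_cf ->]|]; first by rewrite mem_filter => /andP[].
have [i <-] := gf_surj f => newf; exists i => //.
by rewrite mem_filter newf mem_enum.
Qed.

Lemma old_facts m (IM : interp L' 'I_m) s :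
  (forall c, c \in s <-> fact cf cr IM c) ->
  forall c, c \in [seq c <- s | old_fact new_codes c] <->
    fact (fun f => cf (inl f)) cr (reduct IM) c.
Proof.
move=> sP c; rewrite mem_filter; split=> [/andP[+ /sP Ic]|Ic].
  case: c / Ic => [[f|k] a|r a Ir|x y Ixy]; rewrite /old_fact CodeSeq.codeK /=.
  - by move=> _; apply: (@fact_fun L (fun f => cf (inl f)) cr m (reduct IM)).
  - by rewrite mem_new_codes.
  - by move=> _; apply: (@fact_rel L (fun f => cf (inl f)) cr m (reduct IM)).
  by move=> _; apply: (@fact_le L (fun f => cf (inl f)) cr m (reduct IM)).
apply/andP; case: c / Ic => [f a|r a Ir|x y Ixy]; rewrite /old_fact CodeSeq.codeK /=.
- rewrite mem_new_codes; split=> //; apply/sP.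
  exact: (@fact_fun L' cf cr m IM (inl f)).
- by split=> //; apply/sP; apply: (@fact_rel L' cf cr m IM r).
by split=> //; apply/sP; apply: (@fact_le L' cf cr m IM).
Qed.

Variables (na : nat) (ga : 'I_na -> qf L').
Hypothesis gaP : forall p,
  (\bigcup_(k in [set: I]) axioms (L' := L') inl (inr k) (W k)) p <->
  exists i, ga i = p.

Let axiom_codes := [seq qf_code cf cr (ga i) | i <- enum 'I_na].

Variables (d : nat -> nat -> nat) (hT : nat -> nat).
Hypothesis dP : forall m (IM : interp L 'I_m) (s : seq nat), 0 < m ->
  (forall c, c \in s <-> fact (fun f => cf (inl f)) cr IM c) ->
  (d m (CodeSeq.code s) = 1 <-> models IM T).
Hypothesis hTP : forall n (M : structure L) (x : 'I_n -> M),
  models M T -> generated_by M x ->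
  exists N : structure L,
    [/\ extends M N, models N T, lattice_ordered N & [set: N] #<= `I_(hT n)].

Lemma finite_modelP m (IM : interp L' 'I_m) s : 0 < m ->
  (forall c, c \in s <-> fact cf cr IM c) ->
  finite_model funs new_codes axiom_codes d m s <-> models IM (expand W T).
Proof.
move=> m_gt0 sP; have dsP := dP m_gt0 (old_facts sP).
have holdsE p := holds_codeE p inj_cf inj_cr m_gt0 sP.
split=> [/and3P[_ /eqP/dsP IT /allP IW]|IT].
  move=> p [[q Tq <-] v|Wp]; first by apply/sat_lift; apply: IT.
  apply/holdsE; apply: IW; have /gaP[i <-] := Wp.
  by apply: (map_f (fun i => _)); rewrite mem_enum.
apply/and3P; split.
- exact: functional_facts sP.
- by apply/eqP/dsP; case/models_expand: IT.
apply/allP => _ /mapP[i _ ->]; apply/holdsE; apply: IT; right; apply/gaP.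
by exists i.
Qed.

(** A countermodel may be taken to be generated by [c + 1] values, for the code
    [c] of [p], and to be extended to a lattice-ordered one of
    cardinality at most [hT (c + 1)]; moving its domain to an initial segment of
    the natural numbers puts it within the range of the search. *)
Lemma entails_codeP p :
  entails_code funs rels new_codes axiom_codes d hT (qf_code cf cr p) <->
  entails (expand W T) p.
Proof.
split=> [/allP code_p M MT v|Tp].
  apply: contrapT => not_p; set n := (qf_code cf cr p).+1 in code_p.
  have ltn : size (qf_values M v p) < n by rewrite ltnS size_qf_values.
  have [A [x [AT gen_x A_ext]]] := refutation_in_extension leT HW MT not_p ltn.
  have [N [AN NT lattN leN]] := hTP AT gen_x.
  have finN : finite_structure N.
    by apply: card_le_finite leN (finite_II _).
  have [IN [INT not_INp]] := A_ext N AN NT finN lattN.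
  have [m [g [Nm g_inj gP]]] := finite_set_enum finN.
  have g_surj y : exists i, g i = y by apply/gP.
  have [IM IME] := transport_ordinal IN g_inj g_surj.
  have m_gt0 : 0 < m.
    have [y] := Defs.nonempty N; have [i _] := g_surj y.
    exact: leq_ltn_trans (ltn_ord i).
  have lem : m <= hT n by rewrite -card_le_II -(card_le_eql Nm).
  have [s s_in sP] := facts_of_structure cf cr gf_surj gr_surj m_gt0 IM.
  have IMT : models IM (expand W T) by move=> q Tq; apply/IME; apply: INT.
  have := code_p m.-1; rewrite mem_iota /= prednK // => /(_ lem)/allP/(_ s s_in).
  move=> /implyP/(_ _)/(holds_codeE p inj_cf inj_cr m_gt0 sP)/IME.
  by apply/not_implyP; split=> //; apply/(finite_modelP m_gt0 sP).
apply/allP => k _; apply/allP => s s_in; apply/implyP => model_s.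
have /and3P[fun_s _ _] := model_s.
have [IM sP] := structure_of_facts gf_surj (ltn0Sn k) s_in fun_s.
apply/(holds_codeE p inj_cf inj_cr (ltn0Sn k) sP).
pose M := Structure IM (inhabits ord0).
by apply: (Tp M); apply/(finite_modelP (ltn0Sn k) sP).
Qed.

End DecisionCorrect.

Unset Implicit Arguments.

Theorem theorem5p1 (L : language) (T : theory L)
    (HleT : order_axioms L `<=` consequences T)
    (HT : locally_finite T)
    (Hext : forall M : structure L, models M T -> finite_structure M ->
      exists N : structure L,
        [/\ extends M N, models N T, finite_structure N & lattice_ordered N])
    (I : Type) (W : I -> property L) (HW : forall k, admissible T (W k)) :
  (forall p : qf (expansion W),
     (exists M : structure (expansion W), models M (expand W T) /\ ~ holds M p) ->
     exists M : structure (expansion W),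
       [/\ models M (expand W T), finite_structure M & ~ holds M p])
  /\
  (finite_language (expansion W) ->
   forall hT : nat -> nat, recursive1 hT ->
   (forall n (M : structure L) (x : 'I_n -> M),
      models M T -> generated_by M x ->
      exists N : structure L,
        [/\ extends M N, models N T, lattice_ordered N & [set: N] #<= `I_(hT n)]) ->
   forall (cf : funsym (expansion W) -> nat) (cr : relsym (expansion W) -> nat),
   injective cf -> injective cr ->
   decidable_finite_models (fun f => cf (inl f)) cr T ->
   decidable_sentences cf cr (consequences (expand W T))).
Proof.
split=> [p [M [MT not_p]]|[finf finr] hT RhT hTP cf cr inj_cf inj_cr [d Rd dP]].
  have [v not_v] : exists v, ~ sat M v p by apply/existsNP.
  have [A [x [AT gen_x A_ext]]] :=
    refutation_in_extension HleT HW MT not_v (ltnSn (size (qf_values M v p))).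
  have [N [AN NT finN lattN]] := Hext A AT (HT A _ x AT gen_x).
  have [IN [INT not_INp]] := A_ext N AN NT finN lattN.
  by exists (Structure IN (Defs.nonempty N)).
have [nf [gf [_ _ gfP]]] := finite_set_enum finf.
have [nr [gr [_ _ grP]]] := finite_set_enum finr.
have [na [ga [_ _ gaP]]] := finite_set_enum (finite_axioms (conj finf finr)).
have gf_surj f : exists i, gf i = f by apply/gfP.
have gr_surj r : exists i, gr i = r by apply/grP.
have bool1 (b : bool) : nat_of_bool b = 1 <-> b by case: b.
refine (ex_intro2 _ _ _ (recursive_entails_code _ _ _ _ Rd RhT) _) => p.
apply: iff_trans (bool1 _) _.
exact: (entails_codeP HleT HW inj_cf inj_cr gf_surj gr_surj gaP dP hTP p).
Qed.
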